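(* For all $a,b\in \mathbb{R}^g$ and all real numbers $m,d,R>0$ there is an open set $U\subseteq \mathbb{C}^g\times \mathbb{C}^n$ containing $\mathcal{T}_{\leq R}\bigl(C_m^{\ell_{1,1}\geq d}\bigr)$ such that the restriction of the function $\vartheta\begin{bmatrix} a\\ b\end{bmatrix}(z,\tau)$ to $U$ is definable in $\mathbb{R}_{an,exp}$.
   Context: Fix a positive integer $g$ and let $n=g(g+1)/2$; identify $Sym(g,\mathbb{R})$ with $\mathbb{R}^n$ and $Sym(g,\mathbb{C})$ with $\mathbb{C}^n$. Let $\mathcal{H}_g=\{\tau\in Sym(g,\mathbb{C}): Im(\tau) \text{ positive definite}\}$. For $(z,\tau)\in\mathbb{C}^g\times\mathcal{H}_g$, $\vartheta(z,\tau)=\sum_{k\in\mathbb{Z}^g}\exp\bigl(\pi i({}^t k\tau k+2\,{}^t k z)\bigr)$, and for $a,b\in\mathbb{R}^g$ the Riemann theta function with characteristics is $\vartheta\begin{bmatrix} a\\ b\end{bmatrix}(z,\tau)=\exp\bigl(\pi i({}^t a\tau a+2\,{}^t a(z+b))\bigr)\vartheta(z+\tau a+b,\tau)$. A real symmetric matrix $\beta$ is Minkowski reduced if $\beta_{1,1}>0$, ${}^t a\beta a\geq \beta_{k,k}$ for all $k$ and all $a\in\mathbb{Z}^g$ with $\gcd(a_k,\dots,a_g)=1$, and $\beta_{k,k+1}\geq 0$ for $k=1,\dots,g-1$; finitely many of the inequalities ${}^t a\beta a\geq\beta_{k,k}$ suffice. Let $\overline{\mathcal{M}}_g\subseteq Sym(g,\mathbb{R})$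 be the integral polyhedral cone given by $\beta_{1,1}\geq 0$, $\beta_{k,k+1}\geq 0$ ($k=1,\dots,g-1$) and those finitely many inequalities. For real $m>0$, $C_m=\{(y,\beta)\in\mathbb{R}^g\times Sym(g,\mathbb{R}): \beta\in\overline{\mathcal{M}}_g,\ |y_i|\leq m\beta_{i,i} \text{ for } i=1,\dots,g\}$, $\ell_{1,1}(y,\beta)=\beta_{1,1}$, and $C_m^{\ell_{1,1}\geq d}=\{x\in C_m:\ell_{1,1}(x)\geq d\}$. For $S\subseteq\mathbb{R}^N$ and $R>0$, $\mathcal{T}_{\leq R}(S)=\{x+iy\in\mathbb{C}^N: |x_i|\leq R \text{ for all } i,\ y\in S\}$. Here $\mathbb{R}_{an,exp}$ is the expansion of the real field by the real exponential and all restricted analytic functions. *)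

(* Defs.v *)
From HB Require Import structures.
From mathcomp Require Import all_boot all_order all_algebra.
From mathcomp Require Import complex finmap zify lra.
From mathcomp Require Import all_classical all_reals all_analysis.
(* Not imported: summability.sum would shadow the sum type. *)
From mathcomp Require summability.

Set Implicit Arguments.
Unset Strict Implicit.
Unset Printing Implicit Defensive.

Import Order.TTheory GRing.Theory Num.Theory.
Import numFieldNormedType.Exports.

Local Open Scope classical_set_scope.
Local Open Scope ring_scope.
Local Open Scope complex_scope.

(* The topology of the norm on R[i]; the library only provides it on R[i]^o. *)
HB.instance Definition _ (R : realType) :=
  NormedModule.copy R[i] (R[i] : numFieldType)^o.

Section AnExp.
Variable R : realType.

Definition unit_box n : set 'cV[R]_n := [set x | forall i, `|x i 0| <= 1].

(* The filter summability.totally makes the power series converge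
   unconditionally (equivalently, absolutely) to f. *)
Definition analytic_at n (f : 'cV[R]_n -> R) (p : 'cV[R]_n) : Prop :=
  exists (c : {ffun 'I_n -> nat} -> R) (r : R), 0 < r /\
    forall x : 'cV[R]_n, (forall i, `|x i 0 - p i 0| < r) ->
      summability.partial_sum
        (fun alpha => c alpha * \prod_i (x i 0 - p i 0) ^+ alpha i)
        @ summability.totally --> f x.

Definition restricted_analytic n (f : 'cV[R]_n -> R) : Prop :=
  exists F : 'cV[R]_n -> R,
    [/\ forall p, unit_box p -> analytic_at F p,
        forall x, unit_box x -> f x = F x &
        forall x, ~ unit_box x -> f x = 0].

(* TCst makes definability mean definability with real parameters. *)
Inductive term : Type :=
| TVar of nat
| TCst of R
| TAdd of term & term
| TMul of term & term
| TExp of term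
| TAn n (f : 'cV[R]_n -> R) of restricted_analytic f & ('I_n -> term).

Inductive formula : Type :=
| FEq of term & term
| FLt of term & term
| FNot of formula
| FAnd of formula & formula
| FExists of nat & formula.

Fixpoint eval (e : nat -> R) (t : term) : R :=
  match t with
  | TVar j => e j
  | TCst c => c
  | TAdd t1 t2 => eval e t1 + eval e t2
  | TMul t1 t2 => eval e t1 * eval e t2
  | TExp t1 => expR (eval e t1)
  | TAn n f _ ts => f (\col_i eval e (ts i))
  end.

Fixpoint holds (e : nat -> R) (phi : formula) : Prop :=
  match phi with
  | FEq t1 t2 => eval e t1 = eval e t2
  | FLt t1 t2 => eval e t1 < eval e t2
  | FNot phi1 => ~ holds e phi1
  | FAnd phi1 phi2 => holds e phi1 /\ holds e phi2
  | FExists j phi1 => exists r, holds (fun l => if l == j then r else e l) phi1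
  end.

Definition definable n (A : set 'cV[R]_n) : Prop :=
  exists phi : formula,
    forall e : nat -> R, holds e phi <-> A (\col_(i < n) e i).

Definition realify n (w : 'cV[R[i]]_n) : 'cV[R]_(n + n) :=
  col_mx (map_mx (@complex.Re R) w) (map_mx (@complex.Im R) w).

(* The restriction of F to U is definable: its graph is, as a subset of
   R^(2n) x R^2. *)
Definition definable_on n (U : set 'cV[R[i]]_n) (F : 'cV[R[i]]_n -> R[i]) :
    Prop :=
  definable [set v | exists2 w, U w &
    v = col_mx (realify w) (realify (const_mx (F w) : 'cV[R[i]]_1))].

End AnExp.

Definition dim_sym (g : nat) : nat := (g * g.+1)./2.

Definition sym_index (i j : nat) : nat :=
  ((maxn i j * (maxn i j).+1)./2 + minn i j)%N.

Lemma dim_symS g : dim_sym g.+1 = (dim_sym g + g.+1)%N.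
Proof. rewrite /dim_sym; lia. Qed.

Lemma leq_dim_sym g h : (g <= h)%N -> (dim_sym g <= dim_sym h)%N.
Proof. move=> gh; rewrite /dim_sym; apply: half_leq; exact: leq_mul. Qed.

Lemma sym_index_lt g (i j : 'I_g) : (sym_index i j < dim_sym g)%N.
Proof.
have h : (maxn i j < g)%N by rewrite gtn_max !ltn_ord.
rewrite (leq_trans _ (leq_dim_sym h))// dim_symS /sym_index /dim_sym.
lia.
Qed.

Definition sym_ord g (i j : 'I_g) : 'I_(dim_sym g) := Ordinal (sym_index_lt i j).

Definition symmx (K : Type) g (v : 'cV[K]_(dim_sym g)) : 'M[K]_g :=
  \matrix_(i, j) v (sym_ord i j) 0.

Lemma sym_indexC i j : sym_index i j = sym_index j i.
Proof. by rewrite /sym_index maxnC minnC. Qed.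

Lemma sym_index_inj i j i' j' : (i <= j)%N -> (i' <= j')%N ->
  sym_index i j = sym_index i' j' -> i = i' /\ j = j'.
Proof.
move=> ij ij'; rewrite /sym_index !(maxn_idPr _)// !(minn_idPl _)// => e.
have [jj|jj|jj] := ltngtP j j'.
- have := leq_dim_sym jj; rewrite dim_symS /dim_sym; lia.
- have := leq_dim_sym jj; rewrite dim_symS /dim_sym; lia.
- by move: e; rewrite jj => /addnI.
Qed.

Lemma sym_ord_surj g (k : 'I_(dim_sym g)) :
  exists i j : 'I_g, sym_ord i j = k.
Proof.
suff [i [j [ij jg e]]] : exists i j, [/\ (i <= j)%N, (j < g)%N & sym_index i j = k].
  exists (Ordinal (leq_ltn_trans ij jg)), (Ordinal jg); exact/val_inj.
case: k => k /=; elim: g => [//|g IH]; rewrite dim_symS => kg.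
have [{}/IH [i [j [ij jg e]]]|gk] := ltnP k (dim_sym g).
  by exists i, j; split => //; exact: ltnW.
exists (k - dim_sym g)%N, g; have ig : (k - dim_sym g <= g)%N by lia.
split => //; rewrite /sym_index (maxn_idPr ig) (minn_idPl ig) -/(dim_sym g).
lia.
Qed.

Lemma symmx_inj (K : Type) g : injective (@symmx K g).
Proof.
move=> u v uv; apply/matrixP => k l; rewrite ord1.
have [i [j <-]] := sym_ord_surj k.
by have /matrixP/(_ i j) := uv; rewrite !mxE.
Qed.

Lemma symmxP (K : Type) g (A : 'M[K]_g) :
  A^T = A <-> exists v, symmx v = A.
Proof.
split=> [sA|[v <-]]; last first.
  apply/matrixP => i j; rewrite !mxE; congr (v _ _).
  by apply/val_inj; rewrite /= sym_indexC.
have [f fP] : {f : 'I_(dim_sym g) -> 'I_g * 'I_g &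
    forall k, sym_ord (f k).1 (f k).2 = k}.
  apply: (@choice _ _ (fun k p => sym_ord p.1 p.2 = k)) => k.
  by have [i [j ijk]] := sym_ord_surj k; exists (i, j).
have AC i j : A i j = A j i by rewrite -{1}sA mxE.
exists (\col_k A (f k).1 (f k).2); apply/matrixP => i j; rewrite !mxE.
move: (fP (sym_ord i j)); case: (f _) => i' j' /= /(congr1 val) /= e.
wlog ij' : i' j' e / (i' <= j')%N.
  move=> H; case: (leqP i' j') => [|/ltnW] h; first exact: H.
  by rewrite AC; apply: H => //; rewrite sym_indexC.
have [ij|/ltnW ij] := leqP i j.
  by have [/val_inj -> /val_inj ->] := sym_index_inj ij' ij e.
rewrite [RHS]AC; rewrite [RHS]sym_indexC in e.
by have [/val_inj -> /val_inj ->] := sym_index_inj ij' ij e.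
Qed.

Definition qform (K : pzRingType) g (A : 'M[K]_g) (x : 'cV[K]_g) : K :=
  (x^T *m A *m x) 0 0.

Definition dot (K : pzRingType) g (x y : 'cV[K]_g) : K := (x^T *m y) 0 0.

Section Theta.
Variables (R : realType) (g : nat).

Definition posdefmx (A : 'M[R]_g) : Prop :=
  forall x : 'cV[R]_g, x != 0 -> 0 < qform A x.

Definition siegel : set 'M[R[i]]_g :=
  [set tau | tau^T = tau /\ posdefmx (map_mx (@complex.Im R) tau)].

Definition cexp (z : R[i]) : R[i] :=
  (expR (complex.Re z) * cos (complex.Im z)) +i*
  (expR (complex.Re z) * sin (complex.Im z)).

Definition theta (z : 'cV[R[i]]_g) (tau : 'M[R[i]]_g) : R[i] :=
  summability.sum (fun k : 'cV[int]_g =>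
    let kC : 'cV[R[i]]_g := map_mx intr k in
    cexp ((pi : R)%:C * 'i * (qform tau kC + 2 * dot kC z))).

Definition theta_char (a b : 'cV[R]_g) (z : 'cV[R[i]]_g) (tau : 'M[R[i]]_g) :
    R[i] :=
  let aC : 'cV[R[i]]_g := map_mx (real_complex R) a in
  let bC : 'cV[R[i]]_g := map_mx (real_complex R) b in
  cexp ((pi : R)%:C * 'i * (qform tau aC + 2 * dot aC (z + bC))) *
  theta (z + tau *m aC + bC) tau.

End Theta.

Section Minkowski.
Variables (R : realType) (g : nat).
Implicit Types (beta : 'M[R]_g) (k : 'I_g) (a : 'cV[int]_g).

Definition gcd_from k a : nat := \big[gcdn/0%N]_(j < g | (k <= j)%N) absz (a j 0).

Definition minkowski_ineq beta k a : Prop :=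
  beta k k <= qform beta (map_mx intr a).

Definition superdiag_ge0 beta : Prop :=
  forall k l : 'I_g, l = k.+1 :> nat -> 0 <= beta k l.

Definition minkowski_reduced beta : Prop :=
  [/\ beta^T = beta,
      forall k, k = 0%N :> nat -> 0 < beta k k,
      forall k a, gcd_from k a = 1%N -> minkowski_ineq beta k a &
      superdiag_ge0 beta].

(* All the inequalities are imposed here; by minkowski_cone_suff below, any
   subfamily (in particular any finite one) which suffices to define reduced
   matrices defines the same cone. *)
Definition minkowski_cone : set 'M[R]_g :=
  [set beta | [/\ beta^T = beta,
                  forall k, k = 0%N :> nat -> 0 <= beta k k,
                  forall k a, gcd_from k a = 1%N -> minkowski_ineq beta k a &
                  superdiag_ge0 beta]].

Lemma qformD (A B : 'M[R]_g) x : qform (A + B) x = qform A x + qform B x.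
Proof. by rewrite /qform mulmxDr mulmxDl mxE. Qed.

Lemma qformZ c (A : 'M[R]_g) x : qform (c *: A) x = c * qform A x.
Proof. by rewrite /qform -scalemxAr -scalemxAl mxE. Qed.

Lemma minkowski_ineq1 k a : gcd_from k a = 1%N -> minkowski_ineq 1%:M k a.
Proof.
move=> ka; rewrite /minkowski_ineq mxE eqxx /qform mulmx1 mxE.
have [j aj] : exists j, a j 0 != 0.
  apply: contrapT => a0; move: ka; rewrite /gcd_from big1// => j _.
  by apply/eqP; rewrite absz_eq0; apply/negPn/negP => aj; apply: a0; exists j.
rewrite (bigD1 j)//= !mxE -expr2 -[leLHS]addr0 lerD//.
  by rewrite -rmorphXn/= ler1z -gtz0_ge1 exprn_even_gt0.
by apply: sumr_ge0 => l _; rewrite !mxE -expr2 sqr_ge0.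
Qed.

Lemma minkowski_cone_suff (F : set ('I_g * 'cV[int]_g)) :
  (forall k a, F (k, a) -> gcd_from k a = 1%N) ->
  (forall beta, beta^T = beta -> (forall k, k = 0%N :> nat -> 0 < beta k k) ->
    superdiag_ge0 beta -> (forall k a, F (k, a) -> minkowski_ineq beta k a) ->
    minkowski_reduced beta) ->
  forall beta, minkowski_cone beta <->
    [/\ beta^T = beta, forall k, k = 0%N :> nat -> 0 <= beta k k,
        superdiag_ge0 beta & forall k a, F (k, a) -> minkowski_ineq beta k a].
Proof.
move=> Fgcd Fsuff beta; split=> [[sb b0 bI bs]|[sb b0 bs bF]].
  by split=> // k a /Fgcd; exact: bI.
split=> // k a ka; apply/ler_addgt0Pr => e e0.
set q := qform 1%:M (map_mx intr a : 'cV[R]_g).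
have q0 : 0 < 1 + q.
  by have := minkowski_ineq1 ka; rewrite /minkowski_ineq mxE eqxx mulr1n -/q; lra.
pose c := e / (1 + q); have c0 : 0 < c by exact: divr_gt0.
have [_ _ /(_ k a ka) H _] : minkowski_reduced (beta + c *: 1%:M).
  apply: Fsuff.
  - by rewrite linearD linearZ/= trmx1 sb.
  - by move=> l l0; rewrite !mxE eqxx mulr1 ltr_wpDl// b0.
  - move=> l l' ll'; rewrite !mxE addr_ge0 ?bs//.
    by rewrite mulr_ge0 ?ler0n// ltW.
  - move=> l a' la'; rewrite /minkowski_ineq qformD qformZ !mxE.
    have := minkowski_ineq1 (Fgcd _ _ la').
    rewrite /minkowski_ineq mxE => h; apply: lerD; first exact: bF.
    by rewrite ler_pM2l.
move: H; rewrite /minkowski_ineq qformD qformZ !mxE eqxx mulr1n -/q => H.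
have cq : c * (1 + q) = e by rewrite /c divfK// gt_eqF.
by nra.
Qed.

(* Points (y, beta) of R^g x Sym(g, R) are vectors of size g + g(g+1)/2. *)
Definition cone_C (m : R) : set 'cV[R]_(g + dim_sym g) :=
  [set x | minkowski_cone (symmx (dsubmx x)) /\
           forall i : 'I_g, `|usubmx x i 0| <= m * symmx (dsubmx x) i i].

Definition ell11 (hg : (0 < g)%N) (x : 'cV[R]_(g + dim_sym g)) : R :=
  symmx (dsubmx x) (Ordinal hg) (Ordinal hg).

Definition cone_C_ge (hg : (0 < g)%N) (m d : R) : set 'cV[R]_(g + dim_sym g) :=
  [set x | cone_C m x /\ d <= ell11 hg x].

End Minkowski.

Definition tube (R : realType) N (r : R) (S : set 'cV[R]_N) :
    set 'cV[R[i]]_N :=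
  [set w : 'cV[R[i]]_N | (forall i, `|complex.Re (w i 0)| <= r) /\
           S (map_mx (@complex.Im R) w)].

(* Main.v *)
Require Import Defs.
From HB Require Import structures.
From mathcomp Require Import all_boot all_order all_algebra.
From mathcomp Require Import complex finmap zify ring lra.
From mathcomp Require Import all_classical all_reals all_analysis.
From mathcomp Require summability.

Set Implicit Arguments.
Unset Strict Implicit.
Unset Printing Implicit Defensive.

Import Order.TTheory GRing.Theory Num.Theory.
Import numFieldNormedType.Exports.

Local Open Scope classical_set_scope.
Local Open Scope ring_scope.
Local Open Scope complex_scope.

(** Write [beta = Im tau] and [y = Im (z + tau a + b)], so that the k-th term of
    the theta series has modulus [exp (- pi Q_k)], [Q_k = beta[k] + 2 k.y].
    On the Minkowski cone [beta[x] >= c beta_ii x_i^2] for all real [x], with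
    [c] depending on [g] only: approximate [x] by an integer vector (Dirichlet)
    and apply the inequalities defining the cone to its primitive part.  Hence
    the beta-orthogonal projections of the basis vectors have bounded
    coordinates; rounding these to multiples of [1/N] gives an integer matrix
    [W], among finitely many, for which [beta' = W^T beta W] is nearly diagonal.
    For such a [W] there are finitely many linear forms in [(y, beta)], all
    bounded below by a positive constant, of which every [Q_k] is, up to a
    common additive form, a positive multiple of a combination with natural
    coefficients.  On the open set where these forms exceed a positive constant
    and the real parts are bounded, the theta series is therefore a power series
    in the exponentials of the forms and a trigonometric series in the real
    parts, and this defines a restricted analytic function.  The open set [U] is
    the union of these finitely many sets. *)

(** * Unconditional sums *)

(** Natural coefficients make each term a monomial in the exponentials of the forms, and lower
    bounds on the forms keep these exponentials in the unit box. Polarisation gives both: products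
    [x_i x_j] become squares of sums and differences, at the price of subtracting multiples of
    diagonal entries, so the diagonal has to dominate by a factor depending on g. Minkowski
    reduction does not give that much. The matrix [W] does: its off-diagonal entries of [W^T beta W]
    grow like N, the diagonal ones like N^2. In exchange the summation index becomes [adj W k],
    which is still integral, and a factor [(det W)^2] appears. The second obstacle is convergence on
    a neighbourhood of the unit box. The lower bound on the forms leaves a decay exponential in the
    multiplicities, hence Gaussian in k. Enlarging the box by r costs a factor exponential in r
    times a quadratic expression in k, because the frequencies in [Re tau] are quadratic; a small r
    is affordable. The unrestricted exponential serves because the forms are unbounded; sines and
    cosines only occur at bounded arguments. *)

Section UnconditionalSums.
Variable R : realType.

Definition is_sum (I : choiceType) (f : I -> R) (l : R) : Prop :=
  summability.partial_sum f @ summability.totally --> l.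

(** Absolute summability with an explicit constant: [M] acts as a norm that has to be tracked
    through products and nested sums. *)
Definition abs_bounded (I : choiceType) (f : I -> R) (M : R) : Prop :=
  forall A : {fset I}, \sum_(i <- A) `|f i| <= M.

Existing Instance summability.totally_filter.

Lemma partial_sumE (I : choiceType) (V : zmodType) (f : I -> V) (A : {fset I}) :
  summability.partial_sum f A = \sum_(i <- A) f i.
Proof. by rewrite /summability.partial_sum big_seq_fsetE. Qed.

Lemma is_sumP (I : choiceType) (f : I -> R) (l : R) :
  is_sum f l <-> forall e : R, 0 < e -> exists A : {fset I}, forall B : {fset I},
    (A `<=` B)%fset -> `|l - \sum_(i <- B) f i| <= e.
Proof.
split=> [/cvgrPdist_le H e /H [A _ AP]|H].
  by exists A => B AB; have := AP B AB; rewrite /= partial_sumE.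
apply/cvgrPdist_le => e /H [A AP]; exists A => // B AB /=.
by rewrite partial_sumE; exact: AP.
Qed.

Lemma is_sum_unique (I : choiceType) (f : I -> R) (l l' : R) :
  is_sum f l -> is_sum f l' -> l = l'.
Proof. by move=> /cvg_lim <-//; move=> /cvg_lim <-. Qed.

Lemma eq_is_sum (I : choiceType) (f f' : I -> R) (l : R) :
  is_sum f l -> f =1 f' -> is_sum f' l.
Proof. by move=> fl /funext <-. Qed.

Lemma is_sumD (I : choiceType) (f f' : I -> R) (l l' : R) :
  is_sum f l -> is_sum f' l' -> is_sum (fun i => f i + f' i) (l + l').
Proof.
move=> fl fl'; rewrite /is_sum.
rewrite (_ : summability.partial_sum _ =
  summability.partial_sum f \+ summability.partial_sum f'); first exact: cvgD.
by apply/funext => A /=; rewrite !partial_sumE big_split.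
Qed.

Lemma is_sumZ (I : choiceType) (c : R) (f : I -> R) (l : R) :
  is_sum f l -> is_sum (fun i => c * f i) (c * l).
Proof.
move=> fl; rewrite /is_sum.
rewrite (_ : summability.partial_sum _ =
  (fun A => c * summability.partial_sum f A)); first exact: cvgMr.
by apply/funext => A /=; rewrite !partial_sumE big_distrr.
Qed.

Global Arguments is_sumZ {I} c {f l}.

Lemma is_sum0 (I : choiceType) : is_sum (fun _ : I => 0) 0.
Proof.
by apply/is_sumP => e e0; exists fset0 => B _; rewrite big1// subr0 normr0 ltW.
Qed.

Lemma is_sum_sum (I J : choiceType) (s : seq J) (f : J -> I -> R) (l : J -> R) :
  (forall j, is_sum (f j) (l j)) ->
  is_sum (fun i => \sum_(j <- s) f j i) (\sum_(j <- s) l j).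
Proof.
move=> fl; elim: s => [|j s IH].
  by rewrite big_nil; apply: (eq_is_sum (is_sum0 I)) => i; rewrite big_nil.
by rewrite big_cons; apply: (eq_is_sum (is_sumD (fl j) IH)) => i; rewrite big_cons.
Qed.

Global Arguments is_sum_sum {I J} s {f l}.

Lemma is_sum_norm_le (I : choiceType) (f : I -> R) (l M : R) :
  abs_bounded f M -> is_sum f l -> `|l| <= M.
Proof.
move=> fM /is_sumP fl; apply/ler_addgt0Pl => e /fl [A /(_ A (fsubset_refl A))].
move=> lA; rewrite -(subrK (\sum_(i <- A) f i) l).
by rewrite (le_trans (ler_normD _ _))// lerD// (le_trans _ (fM A))// ler_norm_sum.
Qed.

Lemma fset_sum_le (I : choiceType) (f : I -> R) (A B : {fset I}) :
  (forall i, 0 <= f i) -> (A `<=` B)%fset ->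
  \sum_(i <- A) f i <= \sum_(i <- B) f i.
Proof.
move=> f0 AB; rewrite [leRHS](big_fsetID _ [pred i | i \in A])/=.
have -> : [fset x | x in B & x \in A]%fset = A.
  apply/fsetP => i; rewrite !inE /= andbC.
  by case: (boolP (i \in A)) => //= /(fsubsetP AB) ->.
by rewrite lerDl sumr_ge0.
Qed.

Lemma abs_bounded_tail (I : choiceType) (f : I -> R) (M : R) :
  abs_bounded f M -> forall e : R, 0 < e -> exists A : {fset I},
    forall B : {fset I}, [disjoint A & B]%fset -> \sum_(i <- B) `|f i| <= e.
Proof.
move=> fM e e0.
pose S := range (fun A : {fset I} => \sum_(i <- A) `|f i|).
have hS : has_sup S.
  split; first by exists (\sum_(i <- fset0) `|f i|); exists fset0.
  by exists M => _ [A _ <-].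
have [_ [A _ <-] AS] := sup_adherent e0 hS.
exists A => B AB.
have : \sum_(i <- (A `|` B)%fset) `|f i| <= sup S.
  by apply: (ub_le_sup hS.2); exists (A `|` B)%fset.
rewrite (big_fsetID _ [pred i | i \in A])/=.
have -> : [fset x | x in (A `|` B)%fset & x \in A]%fset = A.
  by apply/fsetP => i; rewrite !inE /=; case: (i \in A); rewrite ?andbF ?andbT.
have -> : [fset x | x in (A `|` B)%fset & x \notin A]%fset = B.
  apply/fsetP => i; rewrite !inE /=.
  have := fdisjointP AB i.
  by case: (i \in A) => /=; case: (i \in B) => // /(_ isT).
lra.
Qed.

Lemma abs_bounded_is_sum (I : choiceType) (f : I -> R) (M : R) :
  abs_bounded f M -> exists l, is_sum f l.
Proof.
move=> fM.
(* Writing [f] as [(|f| + f) - |f|] reduces to nonnegative families, whose sum is the supremum of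
   the finite partial sums. *)
suff H (h : I -> R) K : (forall i, 0 <= h i) -> abs_bounded h K -> exists l, is_sum h l.
  have [||l1 h1] := H (fun i => `|f i|) M.
  - by move=> i.
  - move=> A; apply: le_trans (fM A).
    by apply: ler_sum => i _; rewrite normr_id.
  have [||l2 h2] := H (fun i => `|f i| + f i) (2 * M).
  - by move=> i; have := lerNnormlW (lexx `|f i|); lra.
  - move=> A; rewrite (le_trans _ (_ : 2 * \sum_(i <- A) `|f i| <= _))//; last first.
      by rewrite ler_pM2l.
    rewrite mulr_sumr ler_sum// => i _.
    by rewrite (le_trans (ler_normD _ _))// normr_id; lra.
  exists (l2 + -1 * l1); apply: (eq_is_sum (is_sumD h2 (is_sumZ (-1) h1))) => i.
  by rewrite mulN1r addrAC addrN add0r.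
move=> h0 hK.
pose S := range (fun A : {fset I} => \sum_(i <- A) h i).
have hS : has_sup S.
  split; first by exists (\sum_(i <- fset0) h i); exists fset0.
  exists K => _ [A _ <-]; apply: le_trans (hK A).
  by apply: ler_sum => i _; exact: ler_norm.
exists (sup S); apply/is_sumP => e e0.
have [_ [A _ <-] AS] := sup_adherent e0 hS.
exists A => B AB; have := fset_sum_le h0 AB.
have : \sum_(i <- B) h i <= sup S by apply: (ub_le_sup hS.2); exists B.
by move=> ? ?; rewrite ger0_norm; lra.
Qed.

(** Take a finite [A] outside which the absolute sums are at most [e]. Once [B] contains [p(A)], the
    difference between [l] and the sum of [h] over [B] only involves indices with [p i] outside [B],
    hence outside [A]. *)
Lemma is_sum_regroup (I J : choiceType) (p : I -> J) (f : I -> R) (M l : R)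
    (h : J -> R) : abs_bounded f M -> is_sum f l ->
  (forall j, is_sum (fun i => if p i == j then f i else 0) (h j)) ->
  is_sum h l.
Proof.
move=> fM fl hj; apply/is_sumP => e e0.
have [A AP] := abs_bounded_tail fM e0.
exists [fset p i | i in A]%fset => B AB.
have hB := is_sum_sum B hj.
have := is_sumD fl (is_sumZ (-1) hB); rewrite mulN1r.
apply: is_sum_norm_le => C.
have E i : \sum_(j <- B) (if p i == j then f i else 0) =
    if p i \in B then f i else 0.
  rewrite -big_mkcond; case: ifPn => iB.
    rewrite (eq_bigl (pred1 (p i))); last by move=> j /=; rewrite eq_sym.
    by rewrite -big_filter filter_pred1_uniq// big_seq1.
  rewrite big_seq_cond big1// => j /andP[jB /eqP pj]; move: iB.
  by rewrite pj jB.
rewrite (big_fsetID _ [pred i | p i \in B])/= big1_fset ?add0r; last first.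
  move=> i; rewrite !inE /= => /andP[_ iB] _.
  by rewrite E iB mulN1r addrN normr0.
set C' := [fset x | x in _ & _]%fset.
rewrite (eq_big_seq (fun i => `|f i|)) ?AP//.
  apply/fdisjointP => i iA; rewrite !inE /= negb_and negbK.
  by rewrite (fsubsetP AB) ?orbT// in_imfset.
move=> i; rewrite !inE /= => /andP[_ iB].
by rewrite E (negbTE iB) mulr0 addr0.
Qed.

Lemma is_sum_slice (I J : choiceType) (f : I * J -> R) (i : I) (l : R) :
  is_sum (fun j => f (i, j)) l ->
  is_sum (fun x => if x.1 == i then f x else 0) l.
Proof.
move=> /is_sumP fl; apply/is_sumP => e /fl [A AP].
exists [fset (i, j) | j in A]%fset => B AB.
pose Bi := [fset x in B | x.1 == i]%fset; pose B' := [fset x.2 | x in Bi]%fset.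
have -> : \sum_(x <- B) (if x.1 == i then f x else 0) = \sum_(j <- B') f (i, j).
  rewrite -big_mkcond big_fset_condE [RHS]big_imfset/=; last first.
    by move=> [a b] [a' b'] /=; rewrite !inE /= => /andP[_ /eqP ->] /andP[_ /eqP ->] ->.
  by apply: eq_big_seq => -[a b]; rewrite !inE /= => /andP[_ /eqP ->].
apply: AP; apply/fsubsetP => j jA; apply/imfsetP; exists (i, j) => //=.
by rewrite !inE /= eqxx andbT (fsubsetP AB)// in_imfset.
Qed.

Lemma is_sum_pair (I J : choiceType) (f : I * J -> R) (M l : R) (h : I -> R) :
  abs_bounded f M -> is_sum f l ->
  (forall i, is_sum (fun j => f (i, j)) (h i)) -> is_sum h l.
Proof.
by move=> fM fl hi; apply: (is_sum_regroup (p := fst) fM fl) => i; exact: is_sum_slice.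
Qed.

Lemma abs_bounded_pair (I J : choiceType) (f : I * J -> R) (B : I -> R) (M : R) :
  (forall i, abs_bounded (fun j => f (i, j)) (B i)) -> abs_bounded B M ->
  abs_bounded f M.
Proof.
move=> fB BM A.
pose A1 := [fset x.1 | x in A]%fset; pose A2 := [fset x.2 | x in A]%fset.
apply: le_trans (BM A1).
pose A12 : {fset (I * J)%type} := (A1 `*` A2)%fset.
have : \sum_(x <- A) `|f x| <= \sum_(x <- A12) `|f x|.
  apply: fset_sum_le => //; apply/fsubsetP => -[i j] ijA.
  by rewrite in_fsetM; apply/andP; split; apply/imfsetP; exists (i, j).
move=> /le_trans; apply; rewrite big_imfset2/=; last by move=> [? ?] [? ?] _ _ [-> ->].
by apply: ler_sum => i _; rewrite (le_trans (fB i A2))// ler_norm.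
Qed.

End UnconditionalSums.

(** * Power series *)

Section SumExtras.
Variable R : realType.

Lemma le_abs_bounded (I : choiceType) (f h : I -> R) (M M' : R) :
  abs_bounded h M -> (forall i, `|f i| <= `|h i|) -> M <= M' ->
  abs_bounded f M'.
Proof.
by move=> hM fh MM A; rewrite (le_trans _ MM)// (le_trans _ (hM A))// ler_sum.
Qed.

Lemma is_sum_unit (f : unit -> R) : is_sum f (f tt).
Proof.
apply/is_sumP => e e0; exists [fset tt]%fset => B.
rewrite fsub1set => tB; have -> : B = [fset tt]%fset.
  by apply/fsetP => -[]; rewrite !inE.
by rewrite big_seq_fset1 subrr normr0 ltW.
Qed.

Lemma abs_bounded_unit (f : unit -> R) : abs_bounded f `|f tt|.
Proof.
move=> A; have := @fset_sum_le R unit (fun i => `|f i|) A [fset tt]%fset.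
rewrite big_seq_fset1; apply => //.
by apply/fsubsetP => -[] _; rewrite inE.
Qed.

Lemma fset_nat_sub_iota (A : {fset nat}) :
  exists N, forall k, (N <= k)%N -> (A `<=` [fset i in iota 0 k])%fset.
Proof.
exists (\max_(i <- A) i).+1 => k Ak; apply/fsubsetP => i iA.
rewrite !inE /= mem_iota /= (leq_trans _ Ak)// ltnS.
by rewrite (big_fsetD1 i)//= leq_maxl.
Qed.

Lemma sum_iota_fset (f : nat -> R) (k : nat) :
  \sum_(0 <= i < k) f i = \sum_(i <- [fset i in iota 0 k]%fset) f i.
Proof.
rewrite [RHS]big_imfset//= /index_iota subn0.
by rewrite undup_id ?iota_uniq.
Qed.

Lemma is_sum_series (f : nat -> R) (M : R) :
  abs_bounded f M -> is_sum f (limn (series f)).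
Proof.
move=> fM; have [l fl] := abs_bounded_is_sum fM.
suff -> : limn (series f) = l by [].
apply: cvg_lim => //; apply/cvgrPdist_le => e e0.
have [A AP] := (is_sumP f l).1 fl e e0.
have [N AN] := fset_nat_sub_iota A.
exists N => // k /= Nk; rewrite /series/= sum_iota_fset.
exact/AP/AN.
Qed.

Lemma abs_bounded_series (f : nat -> R) (M : R) :
  (forall n, \sum_(0 <= i < n) `|f i| <= M) -> abs_bounded f M.
Proof.
move=> fM A; have [N AN] := fset_nat_sub_iota A.
apply: le_trans (fM N); rewrite sum_iota_fset.
by apply: fset_sum_le => //; exact: AN.
Qed.

Lemma abs_bounded_exp_coeff (x : R) : 0 <= x ->
  abs_bounded (fun k => x ^+ k / k`!%:R) (expR x).
Proof.
move=> x0; apply: abs_bounded_series => n.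
have pos k : 0 <= x ^+ k / k`!%:R by rewrite divr_ge0 ?exprn_ge0.
rewrite (eq_bigr (fun k => x ^+ k / k`!%:R)); last by move=> k _; rewrite ger0_norm.
apply: (nondecreasing_cvgn_le _ (is_cvg_series_exp_coeff x)).
apply/nondecreasing_seqP => k; rewrite /series /= big_nat_recr//= lerDl.
exact: pos.
Qed.

End SumExtras.

Section Pser.
Variables (R : realType) (n : nat) (p : 'cV[R]_n) (r : R).
Hypothesis r0 : 0 < r.
Local Notation MI := {ffun 'I_n -> nat}.
Implicit Types (x : 'cV[R]_n) (f h : 'cV[R]_n -> R).

Definition mon (a : MI) x : R := \prod_i x i 0 ^+ a i.

Definition wt (a : MI) : R := \prod_i r ^+ a i.

Definition near_p x := forall i, `|x i 0 - p i 0| < r.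

(* The norm of [f] in the Wiener algebra of the polydisc of radius [r] about
   [p] is at most [M]. *)
Definition pser f (M : R) : Prop :=
  exists c : MI -> R, abs_bounded (fun a => c a * wt a) M /\
    forall x, near_p x -> is_sum (fun a => c a * mon a (x - p)) (f x).

Lemma wt_gt0 a : 0 < wt a. Proof. by apply: prodr_gt0 => i _; rewrite exprn_gt0. Qed.

Lemma monD (a b : MI) x : mon [ffun i => (a i + b i)%N] x = mon a x * mon b x.
Proof. by rewrite /mon -big_split; apply: eq_bigr => i _; rewrite ffunE exprD. Qed.

Lemma wtD (a b : MI) : wt [ffun i => (a i + b i)%N] = wt a * wt b.
Proof. by rewrite /wt -big_split; apply: eq_bigr => i _; rewrite ffunE exprD. Qed.

Lemma mon_le_wt (a : MI) x : near_p x -> `|mon a (x - p)| <= wt a.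
Proof.
move=> xp; rewrite /mon normr_prod; apply: ler_prod => i _.
by rewrite normr_ge0 normrX lerXn2r// ?nnegrE ?(ltW r0)// !mxE ltW// xp.
Qed.

(** Lets a power series be given with repeated exponents, as products and infinite sums of power
    series produce them; the coefficients are collected along the fibres of [a]. *)
Lemma pser_regroup (I : choiceType) (c : I -> R) (a : I -> MI) f (M : R) :
  abs_bounded (fun i => c i * wt (a i)) M ->
  (forall x, near_p x -> is_sum (fun i => c i * mon (a i) (x - p)) (f x)) ->
  pser f M.
Proof.
move=> cM cf.
have bnd (b : MI) : abs_bounded (fun i => if a i == b then c i * wt (a i) else 0) M.
  by apply: (le_abs_bounded cM) => // i; case: ifP => //; rewrite normr0.
have [l lP] : {l : MI -> R & forall b,
    is_sum (fun i => if a i == b then c i * wt (a i) else 0) (l b)}.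
  apply: (@choice _ _ (fun b l => is_sum (fun i => if a i == b then c i * wt (a i) else 0) l)) => b.
  exact: abs_bounded_is_sum (bnd b).
exists (fun b => l b / wt b); split=> [A|x xp].
  (* With the signs inserted, the sum of the [|l b|] over [A] is again an unconditional sum over
     [I], whose terms are dominated by those of [c i * wt (a i)]. *)
  rewrite (eq_bigr (fun b => Num.sg (l b) * l b)); last first.
    by move=> b _; rewrite divfK ?gt_eqF ?wt_gt0// normrEsg.
  have := is_sum_sum A (fun b => is_sumZ (Num.sg (l b)) (lP b)).
  move=> /(is_sum_norm_le _) H; apply: le_trans (ler_norm _) (H _ _).
  apply: (le_abs_bounded cM) => // i.
  rewrite (eq_bigr (fun b => if a i == b then Num.sg (l b) * (c i * wt (a i)) else 0)); last first.
    by move=> b _; case: ifP => //; rewrite mulr0.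
  rewrite -big_mkcond; have [iA|iA] := boolP (a i \in A).
    rewrite (eq_bigl (pred1 (a i))); last by move=> j /=; rewrite eq_sym.
    rewrite -big_filter filter_pred1_uniq ?fset_uniq//. rewrite big_seq1 normrM ler_piMl//.
    by rewrite normr_sg; case: (_ == 0).
  rewrite big_seq_cond big1 ?normr0// => b /andP[bA /eqP ab].
  by move: iA; rewrite ab bA.
have cM' : abs_bounded (fun i => c i * mon (a i) (x - p)) M.
  apply: (le_abs_bounded cM) => // i; rewrite !normrM ler_wpM2l//.
  by rewrite (le_trans (mon_le_wt _ xp))// ler_norm.
apply: (is_sum_regroup (p := a) cM' (cf x xp)) => b.
have := is_sumZ (mon b (x - p) / wt b) (lP b).
rewrite [_ * l b]mulrAC [mon _ _ * l b]mulrC -[l b * _ / _]mulrA [mon _ _ / _]mulrC mulrA.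
move=> /eq_is_sum; apply => i; case: eqP => [->|]; last by rewrite mulr0.
by field; rewrite gt_eqF ?wt_gt0.
Qed.

Lemma pser_ge0 f M : pser f M -> 0 <= M.
Proof. by case=> c [/(_ fset0)]; rewrite big_seq_fset0. Qed.

Lemma pser_le f M M' : pser f M -> M <= M' -> pser f M'.
Proof. by case=> c [cM cf] MM; exists c; split => //; exact: le_abs_bounded cM _ MM. Qed.

Lemma pser_ext f h M : pser f M -> (forall x, near_p x -> f x = h x) -> pser h M.
Proof.
by case=> c [cM cf] fh; exists c; split => // x xp; rewrite -fh//; exact: cf.
Qed.

Lemma pser_mon (c : R) (a : MI) : pser (fun x => c * mon a (x - p)) (`|c| * wt a).
Proof.
apply: (@pser_regroup unit (fun=> c) (fun=> a)) => [|x _].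
  apply: (le_abs_bounded (@abs_bounded_unit _ (fun=> c * wt a))) => //.
  by rewrite normrM (ger0_norm (ltW (wt_gt0 a))).
exact: is_sum_unit.
Qed.

Lemma pser_cst (c : R) : pser (fun=> c) `|c|.
Proof.
have := pser_mon c [ffun=> 0%N]; rewrite /mon /wt big1 ?mulr1; last first.
  by move=> i _; rewrite ffunE.
move=> /pser_ext; apply => x _; rewrite big1 ?mulr1// => i _.
by rewrite ffunE.
Qed.

Lemma pserM f h M M' : pser f M -> pser h M' -> pser (fun x => f x * h x) (M * M').
Proof.
move=> fM hM'; have M'0 := pser_ge0 hM'.
case: fM hM' => [c [cM cf]] [d [dM dh]].
pose cd (x : MI * MI) := c x.1 * d x.2.
pose ab (x : MI * MI) : MI := [ffun i => (x.1 i + x.2 i)%N].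
have key (u v : MI -> R) : abs_bounded u M -> abs_bounded v M' ->
    abs_bounded (fun x : MI * MI => u x.1 * v x.2) (M * M').
  move=> uM vM; apply: (@abs_bounded_pair _ _ _ _ (fun a => `|u a| * M')).
    move=> a A /=; rewrite (eq_bigr (fun j => `|u a| * `|v j|)); last first.
      by move=> j _; rewrite normrM.
    by rewrite -big_distrr/= ler_wpM2l.
  move=> A; rewrite (eq_bigr (fun a => `|u a| * M')); last first.
    by move=> a _; rewrite ger0_norm// mulr_ge0.
  by rewrite -big_distrl/= ler_wpM2r.
apply: (@pser_regroup _ cd ab) => [|x xp].
  apply: (le_abs_bounded (key _ _ cM dM)) => // -[a b].
  by rewrite /cd /ab /= wtD mulrACA.
have bx (e : MI -> R) K : abs_bounded (fun a => e a * wt a) K ->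
    abs_bounded (fun a => e a * mon a (x - p)) K.
  move=> eK; apply: (le_abs_bounded eK) => // a; rewrite !normrM ler_wpM2l//.
  by rewrite (le_trans (mon_le_wt _ xp))// ler_norm.
have B := key _ _ (bx _ _ cM) (bx _ _ dM).
have [l Hl] := abs_bounded_is_sum B.
have H1 : is_sum (fun a => c a * mon a (x - p) * h x) l.
  by apply: (is_sum_pair B Hl) => a /=; apply: is_sumZ; exact: dh.
have H2 : is_sum (fun a => c a * mon a (x - p) * h x) (h x * f x).
  by apply: (eq_is_sum (is_sumZ (h x) (cf x xp))) => a; rewrite mulrC.
rewrite mulrC -(is_sum_unique H1 H2); apply: (eq_is_sum Hl) => -[a b].
by rewrite /cd /ab /= monD mulrACA.
Qed.

(** The norm bounds make the family of all monomials of all [F k] absolutely summable, so the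
    infinite sum rearranges into one power series without any Cauchy estimate. *)
Lemma pser_sum (K : choiceType) (F : K -> 'cV[R]_n -> R) (B : K -> R) f M :
  (forall k, pser (F k) (B k)) -> abs_bounded B M ->
  (forall x, near_p x -> is_sum (fun k => F k x) (f x)) -> pser f M.
Proof.
move=> FB BM Ff.
have [c cP] := @choice _ _ (fun k (c : MI -> R) =>
  abs_bounded (fun a => c a * wt a) (B k) /\
    forall x, near_p x -> is_sum (fun a => c a * mon a (x - p)) (F k x)) FB.
pose cc (x : K * MI) := c x.1 x.2.
have Bw : abs_bounded (fun x : K * MI => cc x * wt x.2) M.
  by apply: abs_bounded_pair BM => k; have [] := cP k.
apply: (@pser_regroup _ cc snd) => // x xp.
have Bx : abs_bounded (fun y : K * MI => cc y * mon y.2 (x - p)) M.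
  apply: (le_abs_bounded Bw) => // a; rewrite !normrM ler_wpM2l//.
  by rewrite (le_trans (mon_le_wt _ xp))// ler_norm.
have [l Hl] := abs_bounded_is_sum Bx.
suff -> : f x = l by [].
apply: (is_sum_unique (Ff x xp)); apply: (is_sum_pair Bx Hl) => k /=.
by have [_] := cP k; apply.
Qed.

Lemma pserD f h M M' : pser f M -> pser h M' -> pser (fun x => f x + h x) (M + M').
Proof.
move=> [c [cM cf]] [d [dM dh]]; exists (fun a => c a + d a); split=> [A|x xp].
  rewrite (le_trans _ (lerD (cM A) (dM A)))// -big_split/= ler_sum// => a _.
  by rewrite mulrDl ler_normD.
by apply: (eq_is_sum (is_sumD (cf x xp) (dh x xp))) => a; rewrite mulrDl.
Qed.

Lemma pserX f M k : pser f M -> pser (fun x => f x ^+ k) (M ^+ k).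
Proof.
move=> fM; elim: k => [|k IH].
  by have := pser_cst 1; rewrite normr1.
by have := pserM fM IH; rewrite -exprS => /pser_ext; apply => x _; rewrite exprS.
Qed.

Lemma pser_bigprod (J : Type) (s : seq J) (F : J -> 'cV[R]_n -> R) (B : J -> R) :
  (forall j, pser (F j) (B j)) ->
  pser (fun x => \prod_(j <- s) F j x) (\prod_(j <- s) B j).
Proof.
move=> FB; elim: s => [|j s IH].
  rewrite big_nil; have := pser_cst 1; rewrite normr1 => /pser_ext; apply => x _.
  by rewrite big_nil.
rewrite big_cons; apply: (pser_ext (pserM (FB j) IH)) => x _.
by rewrite big_cons.
Qed.

Lemma pser_bigsum (J : Type) (s : seq J) (F : J -> 'cV[R]_n -> R) (B : J -> R) :
  (forall j, pser (F j) (B j)) ->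
  pser (fun x => \sum_(j <- s) F j x) (\sum_(j <- s) B j).
Proof.
move=> FB; elim: s => [|j s IH].
  rewrite big_nil; have := pser_cst 0; rewrite normr0 => /pser_ext; apply => x _.
  by rewrite big_nil.
rewrite big_cons; apply: (pser_ext (pserD (FB j) IH)) => x _.
by rewrite big_cons.
Qed.

Lemma pser_dcoord (i : 'I_n) : pser (fun x => x i 0 - p i 0) r.
Proof.
have := pser_mon 1 [ffun j => nat_of_bool (j == i)].
have E (y : 'I_n -> R) : \prod_j y j ^+ [ffun j => nat_of_bool (j == i)] j = y i.
  rewrite (bigD1 i)//= ffunE eqxx expr1 big1 ?mulr1// => j /negbTE ji.
  by rewrite ffunE ji.
rewrite normr1 mul1r /wt E => /pser_ext; apply => x _.
by rewrite mul1r /mon (E (fun j => (x - p) j 0)) !mxE.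
Qed.

Lemma pser_coord (i : 'I_n) : pser (fun x => x i 0) (`|p i 0| + r).
Proof.
apply: (pser_ext (pserD (pser_cst (p i 0)) (pser_dcoord i))) => x _.
by rewrite addrC subrK.
Qed.

(** The exponential series is a majorant. The sum is written as a limit of partial sums because
    [cos] and [sin] are defined that way. *)
Lemma pser_entire (s : nat -> R) f M : (forall k, `|s k| <= k`!%:R^-1) ->
  pser f M -> pser (fun x => limn (series (fun k => s k * f x ^+ k))) (expR M).
Proof.
move=> sk fM; have M0 := pser_ge0 fM.
have [c [cM cf]] := fM.
have fx x : near_p x -> `|f x| <= M.
  move=> xp; apply: is_sum_norm_le (cf x xp).
  apply: (le_abs_bounded cM) => // a; rewrite !normrM ler_wpM2l//.
  by rewrite (le_trans (mon_le_wt _ xp))// ler_norm.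
apply: (@pser_sum _ (fun k x => s k * f x ^+ k) (fun k => `|s k| * M ^+ k)).
- by move=> k; exact: pserM (pser_cst _) (pserX k fM).
- apply: (le_abs_bounded (abs_bounded_exp_coeff M0)) => // k.
  by rewrite [M ^+ k / _]mulrC !normrM normr_id ler_wpM2r// ger0_norm// invr_ge0.
- move=> x xp; apply: (@is_sum_series _ _ (expR M)).
  apply: (le_abs_bounded (abs_bounded_exp_coeff M0)) => // k.
  rewrite [M ^+ k / _]mulrC !normrM; apply: ler_pM => //.
    by rewrite (@ger0_norm _ (k`!%:R^-1)) ?invr_ge0.
  by rewrite !normrX lerXn2r ?nnegrE// (le_trans (fx x xp))// ler_norm.
Qed.

Lemma pser_cos f M : pser f M -> pser (fun x => cos (f x)) (expR M).
Proof.
move=> fM; pose s k : R := (~~ odd k)%:R * (-1) ^ k./2 * k`!%:R^-1.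
have /pser_entire/(_ fM) : forall k, `|s k| <= k`!%:R^-1.
  move=> k; rewrite /s !normrM normrX normrN1 expr1n mulr1 (@ger0_norm _ (k`!%:R^-1)) ?invr_ge0//.
  by rewrite ler_piMl ?invr_ge0//; case: (odd k); rewrite ?normr0 ?normr1.
move=> /pser_ext; apply => x _; rewrite unlock; congr (limn (series _)).
by apply/funext => k; rewrite /s /cos_coeff /= mulrAC.
Qed.

Lemma pser_sin f M : pser f M -> pser (fun x => sin (f x)) (expR M).
Proof.
move=> fM; pose s k : R := (odd k)%:R * (-1) ^+ k.-1./2 * k`!%:R^-1.
have /pser_entire/(_ fM) : forall k, `|s k| <= k`!%:R^-1.
  move=> k; rewrite /s !normrM normrX normrN1 expr1n mulr1 (@ger0_norm _ (k`!%:R^-1)) ?invr_ge0//.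
  by rewrite ler_piMl ?invr_ge0//; case: (odd k); rewrite ?normr0 ?normr1.
move=> /pser_ext; apply => x _; rewrite unlock; congr (limn (series _)).
by apply/funext => k; rewrite /s /sin_coeff /= mulrAC.
Qed.

(** The addition formula isolates the phase at the centre [p], so the bound involves only [r] and
    not the size of [p] or [phi]. Bounding the linear form itself would cost [|p j 0| + r] in place
    of [r], and the quadratically growing frequencies of the theta series could then outweigh its
    decay. *)
Lemma pser_cos_linear (L : 'I_n -> R) (phi : R) :
  pser (fun x => cos (\sum_j L j * x j 0 + phi)) (2 * expR (\sum_j `|L j| * r)).
Proof.
have dL : pser (fun x => \sum_j L j * (x j 0 - p j 0)) (\sum_j `|L j| * r).
  by apply: pser_bigsum => j; exact: pserM (pser_cst _) (pser_dcoord j).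
pose q := \sum_j L j * p j 0 + phi.
have := pserD (pserM (pser_cst (cos q)) (pser_cos dL))
              (pserM (pser_cst (- sin q)) (pser_sin dL)).
move=> S; apply: (@pser_le _ (`|cos q| * expR (\sum_j `|L j| * r) +
     `|- sin q| * expR (\sum_j `|L j| * r))).
  apply: (pser_ext S) => x _; rewrite mulNr -cosD; congr cos.
  rewrite /q addrAC -big_split/=; congr (_ + _); apply: eq_bigr => j _.
  by rewrite -mulrDr addrC subrK.
rewrite -mulrDl ler_wpM2r ?expR_ge0// normrN.
by rewrite (_ : 2 = 1 + 1)// lerD// ler_norml ?cos_geN1 ?cos_le1 ?sin_geN1 ?sin_le1.
Qed.

End Pser.

(** * Restricted analytic functions from mixed power and trigonometric series *)

Section RestrictedSeries.
Variables (R : realType) (n : nat).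

Lemma pser_analytic (p : 'cV[R]_n) (r : R) (f : 'cV[R]_n -> R) (M : R) :
  0 < r -> pser p r f M -> analytic_at f p.
Proof.
move=> r0 [c [_ cf]]; exists c, r; split => // x xp.
apply: (eq_is_sum (cf x xp)) => a; congr (_ * _).
by apply: eq_bigr => i _; rewrite !mxE.
Qed.

Definition trig_term (I : choiceType) (c : I -> R) (e : I -> 'I_n -> nat)
    (L : I -> 'I_n -> R) (phi : R) (x : 'cV[R]_n) (i : I) : R :=
  c i * \prod_j x j 0 ^+ e i j * cos (\sum_j L i j * x j 0 + phi).

(** The series converges on the box of radius [1 + r], which contains the polydisc of radius [r]
    about every point of the unit box; the expansion about each such point has norm at most [2 * M],
    the 2 coming from [pser_cos_linear]. *)
Lemma restricted_analytic_trig_series (I : choiceType) (c : I -> R)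
    (e : I -> 'I_n -> nat) (L : I -> 'I_n -> R) (phi r M : R) : 0 < r ->
  abs_bounded (fun i => c i * \prod_j (1 + r) ^+ e i j *
                        expR (\sum_j `|L i j| * r)) M ->
  exists2 f, restricted_analytic f &
    forall x, unit_box x -> is_sum (trig_term c e L phi x) (f x).
Proof.
move=> r0 cM.
have bnd (x : 'cV[R]_n) : (forall j, `|x j 0| <= 1 + r) ->
    abs_bounded (trig_term c e L phi x) M.
  move=> xr; apply: (le_abs_bounded cM) => // i; rewrite /trig_term !normrM.
  apply: ler_pM => //; rewrite ?mulr_ge0//.
    rewrite ler_wpM2l// !normr_prod; apply: ler_prod => j _.
    rewrite normr_ge0 !normrX lerXn2r// ?nnegrE//.
    by rewrite (le_trans (xr j))// ler_norm.
  rewrite (@le_trans _ _ 1)//; first by rewrite ler_norml cos_geN1 cos_le1.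
  rewrite (le_trans _ (ler_norm _))// -expR0 ler_expR.
  by apply: sumr_ge0 => j _; rewrite mulr_ge0// ltW.
have ex (x : 'cV[R]_n) : exists l, (forall j, `|x j 0| <= 1 + r) ->
    is_sum (trig_term c e L phi x) l.
  have [xr|xr] := pselect (forall j, `|x j 0| <= 1 + r); last by exists 0 => /xr.
  by have [l ?] := abs_bounded_is_sum (bnd x xr); exists l.
have [F FP] := @choice _ _ _ ex.
exists (fun x => if `[< unit_box x >] then F x else 0); last first.
  move=> x xb; rewrite asboolT//; apply: FP => j.
  by rewrite (le_trans (xb j))// lerDl ltW.
exists F; split.
- move=> p pb; apply: (pser_analytic r0).
  apply: (@pser_sum _ _ p r r0 I (fun i x => trig_term c e L phi x i)
    (fun i => `|c i| * \prod_j (`|p j 0| + r) ^+ e i j *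
              (2 * expR (\sum_j `|L i j| * r))) F (2 * M)).
  + move=> i; apply: pserM => //; last exact: pser_cos_linear.
    apply: pserM => //; first exact: pser_cst.
    by apply: pser_bigprod => // j; apply: pserX => //; exact: pser_coord.
  + move=> A; rewrite (le_trans _ (_ : 2 * \sum_(i <- A) `|c i * \prod_j (1 + r) ^+ e i j *
                        expR (\sum_j `|L i j| * r)| <= _))//; last by rewrite ler_pM2l.
    rewrite mulr_sumr; apply: ler_sum => i _.
    rewrite !normrM normr_id (@ger0_norm _ 2)// mulrCA ler_pM2l//.
    rewrite ler_wpM2r// ler_wpM2l// !normr_prod; apply: ler_prod => j _.
    have h : 0 <= `|p j 0| + r by rewrite addr_ge0// ltW.
    have h1 : 0 <= 1 + r by rewrite addr_ge0// ltW.
    rewrite normr_ge0 !normrX (ger0_norm h) (ger0_norm h1) lerXn2r// lerD2r.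
    exact: pb.
  + move=> x xp; apply: FP => j; rewrite -(subrK (p j 0) (x j 0)).
    by rewrite (le_trans (ler_normD _ _))// addrC lerD// ltW.
- by move=> x xb; rewrite asboolT.
- by move=> x xb; rewrite asboolF.
Qed.

End RestrictedSeries.

(** * Definable functions and sets *)

Section Definability.
Variable R : realType.
Implicit Types (e : nat -> R) (f h : (nat -> R) -> R) (A B : (nat -> R) -> Prop).

(** Single terms suffice: every function met below is a term on the piece where it is used, so no
    quantifier is ever built. *)
Definition term_fun f : Prop := exists t : term R, forall e, Defs.eval e t = f e.

Definition form_set A : Prop := exists phi : formula R, forall e, holds e phi <-> A e.

Lemma term_fun_ext f h : term_fun f -> f =1 h -> term_fun h.
Proof. by move=> [t tf] fh; exists t => e; rewrite tf fh. Qed.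

Lemma term_fun_var k : term_fun (fun e => e k).
Proof. by exists (TVar R k). Qed.

Lemma term_fun_cst (c : R) : term_fun (fun=> c).
Proof. by exists (TCst c). Qed.

Lemma term_funD f h : term_fun f -> term_fun h -> term_fun (fun e => f e + h e).
Proof. by move=> [t tf] [u uh]; exists (TAdd t u) => e /=; rewrite tf uh. Qed.

Lemma term_funM f h : term_fun f -> term_fun h -> term_fun (fun e => f e * h e).
Proof. by move=> [t tf] [u uh]; exists (TMul t u) => e /=; rewrite tf uh. Qed.

Lemma term_fun_expR f : term_fun f -> term_fun (fun e => expR (f e)).
Proof. by move=> [t tf]; exists (TExp t) => e /=; rewrite tf. Qed.

Lemma term_funN f : term_fun f -> term_fun (fun e => - f e).
Proof.
by move=> /(term_funM (term_fun_cst (-1)))/term_fun_ext; apply => e; rewrite mulN1r.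
Qed.

Lemma term_funB f h : term_fun f -> term_fun h -> term_fun (fun e => f e - h e).
Proof. by move=> tf /term_funN; exact: term_funD. Qed.

Lemma term_fun_sum (J : Type) (s : seq J) (F : J -> (nat -> R) -> R) :
  (forall j, term_fun (F j)) -> term_fun (fun e => \sum_(j <- s) F j e).
Proof.
move=> tF; elim: s => [|j s IH].
  by apply: (term_fun_ext (term_fun_cst 0)) => e; rewrite big_nil.
by apply: (term_fun_ext (term_funD (tF j) IH)) => e; rewrite big_cons.
Qed.

Lemma term_fun_an n (f : 'cV[R]_n -> R) (F : 'I_n -> (nat -> R) -> R) :
  restricted_analytic f -> (forall i, term_fun (F i)) ->
  term_fun (fun e => f (\col_i F i e)).
Proof.
move=> rf /(@choice _ _ (fun i t => forall e, Defs.eval e t = F i e)) [t tF].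
exists (TAn rf t) => e /=; congr f.
by apply/matrixP => i j; rewrite !mxE.
Qed.

(** The cosine is only available on bounded intervals. It is obtained as a one-term trigonometric
    series after scaling the argument by [L]. *)
Lemma term_fun_cos_bounded f (L phi : R) : term_fun f -> 0 < L ->
  exists2 h, term_fun h & forall e, `|f e| <= L -> h e = cos (f e + phi).
Proof.
move=> tf L0.
have [F rF FP] := @restricted_analytic_trig_series R 1 unit (fun=> 1)
  (fun _ _ => 0%N) (fun _ _ => L) phi 1 _ ltr01 (@abs_bounded_unit _ _).
exists (fun e => F (\col_i (L^-1 * f e))).
    by apply: term_fun_an => // _; apply: term_funM => //; exact: term_fun_cst.
  move=> e fL; have xb : unit_box (\col_(i < 1) (L^-1 * f e)).
    move=> i; rewrite mxE normrM gtr0_norm ?invr_gt0//.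
    by rewrite mulrC ler_pdivrMr// mul1r.
  have := is_sum_unique (FP _ xb) (@is_sum_unit R _); rewrite /trig_term => ->.
  rewrite !big_ord1 !mxE mul1r expr0 mul1r mulrA divff ?gt_eqF// mul1r//.
Qed.

Lemma form_set_ext A B : form_set A -> (forall e, A e <-> B e) -> form_set B.
Proof. by move=> [phi Hp] AB; exists phi => e; rewrite Hp. Qed.

Lemma form_set_lt f h : term_fun f -> term_fun h -> form_set (fun e => f e < h e).
Proof. by move=> [t tf] [u uh]; exists (FLt t u) => e /=; rewrite tf uh. Qed.

Lemma form_set_eq f h : term_fun f -> term_fun h -> form_set (fun e => f e = h e).
Proof. by move=> [t tf] [u uh]; exists (FEq t u) => e /=; rewrite tf uh. Qed.

Lemma form_setN A : form_set A -> form_set (fun e => ~ A e).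
Proof. by move=> [phi Hp]; exists (FNot phi) => e /=; rewrite Hp. Qed.

Lemma form_setI A B : form_set A -> form_set B -> form_set (fun e => A e /\ B e).
Proof. by move=> [phi Hp] [psi Hq]; exists (FAnd phi psi) => e /=; rewrite Hp Hq. Qed.

Lemma form_set_forall (T : finType) (F : T -> (nat -> R) -> Prop) :
  (forall t, form_set (F t)) -> form_set (fun e => forall t, F t e).
Proof.
move=> FF; suff H (s : seq T) : form_set (fun e => forall t, t \in s -> F t e).
  apply: (form_set_ext (H (enum T))) => e; split=> Fe t; last by move=> _; exact: Fe.
  by apply: Fe; rewrite mem_enum.
elim: s => [|t s IH].
  by apply: (form_set_ext (form_set_eq (term_fun_cst 0) (term_fun_cst 0))) => e.
apply: (form_set_ext (form_setI (FF t) IH)) => e; split.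
  by move=> [Ft Fs] u; rewrite inE => /orP[/eqP -> //|]; exact: Fs.
by move=> Fs; split=> [|u us]; apply: Fs; rewrite inE ?eqxx ?us ?orbT.
Qed.

Lemma form_set_exists (T : finType) (F : T -> (nat -> R) -> Prop) :
  (forall t, form_set (F t)) -> form_set (fun e => exists t, F t e).
Proof.
move=> FF.
have := form_setN (form_set_forall (fun t => form_setN (FF t))).
move=> /form_set_ext; apply => e; split=> [/existsNP [t /contrapT Ft]|[t Ft] H].
  by exists t.
exact: (H t).
Qed.

(** Follows the layout of the graph in [definable_on]: n real parts, then n imaginary parts. The
    variables [n + n] and [(n + n).+1] are left for the value. *)
Definition env_vec n e : 'cV[R[i]]_n := \col_(i < n) (e i +i* e (n + i)%N).

(** The graph is a finite union of sets given by a formula for the piece and two equations for the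
    value. All pieces describe the same [F], so their overlaps need no gluing. *)
Lemma definable_on_cover n (T : finType) (V : T -> set 'cV[R[i]]_n)
    (F : 'cV[R[i]]_n -> R[i]) :
  (forall t, form_set (fun e => V t (env_vec n e))) ->
  (forall t, exists fr fi, [/\ term_fun fr, term_fun fi &
     forall e, V t (env_vec n e) -> F (env_vec n e) = fr e +i* fi e]) ->
  definable_on [set w | exists t, V t w] F.
Proof.
move=> VF VT.
have [fr /choice [fi H]] := choice VT.
suff [phi Hp] : form_set (fun e => exists t, V t (env_vec n e) /\
    (e (n + n)%N = fr t e /\ e (n + n).+1 = fi t e)).
  exists phi => e; rewrite Hp; split.
    move=> [t [Vt [e1 e2]]]; exists (env_vec n e); first by exists t.
    have [_ _ /(_ e Vt) Ft] := H t.
    apply/matrixP => i j; rewrite !mxE; case: splitP => k ik; rewrite !mxE.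
      by case: splitP => l kl; rewrite !mxE ik kl.
    by case: splitP => l kl; rewrite !mxE Ft /= ik kl ord1 ?addn0 ?addn1.
  move=> [w [t Vt] E].
  have wE : w = env_vec n e.
    apply/matrixP => i j; rewrite ord1 mxE.
    have /matrixP/(_ (lshift _ (lshift _ i)) 0) := E.
    rewrite col_mxEu col_mxEu !mxE /= => ->.
    have /matrixP/(_ (lshift _ (rshift _ i)) 0) := E.
    rewrite col_mxEu col_mxEd !mxE /= => ->.
    by case: (w i 0).
  rewrite wE in Vt; exists t; split=> //.
  have [_ _ /(_ e Vt) Ft] := H t; rewrite -wE in Ft.
  have /matrixP/(_ (rshift _ (lshift _ 0)) 0) := E.
  rewrite col_mxEd col_mxEu !mxE /= addn0 Ft /= => ->.
  have /matrixP/(_ (rshift _ (rshift _ 0)) 0) := E.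
  by rewrite col_mxEd col_mxEd !mxE /= addn1 Ft /= => ->.
apply: form_set_exists => t; have [tr ti _] := H t.
by apply: form_setI => //; apply: form_setI; apply: form_set_eq => //;
  exact: term_fun_var.
Qed.

End Definability.

(** * Minkowski reduction *)

Section BilinearForms.
Variables (R : realType) (g : nat).
Implicit Types (A : 'M[R]_g) (x y z : 'cV[R]_g).

Definition bform A x y : R := (x^T *m A *m y) 0 0.

Lemma bformE A x y : bform A x y = \sum_i \sum_j x i 0 * A i j * y j 0.
Proof.
rewrite /bform mxE exchange_big /=; apply: eq_bigr => j _.
by rewrite mxE big_distrl/=; apply: eq_bigr => i _; rewrite mxE.
Qed.

Lemma bformDl A x y z : bform A (x + y) z = bform A x z + bform A y z.
Proof. by rewrite /bform linearD/= !mulmxDl mxE. Qed.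

Lemma bformDr A x y z : bform A x (y + z) = bform A x y + bform A x z.
Proof. by rewrite /bform mulmxDr mxE. Qed.

Lemma bformZl A (c : R) x y : bform A (c *: x) y = c * bform A x y.
Proof. by rewrite /bform linearZ/= -!scalemxAl mxE. Qed.

Lemma bformZr A (c : R) x y : bform A x (c *: y) = c * bform A x y.
Proof. by rewrite /bform -!scalemxAr mxE. Qed.

Lemma bformC A x y : A^T = A -> bform A x y = bform A y x.
Proof.
move=> sA; rewrite !bformE exchange_big; apply: eq_bigr => i _.
apply: eq_bigr => j _; have -> : A j i = A i j by have /matrixP/(_ i j) := sA; rewrite mxE.
by ring.
Qed.

Lemma qform_bform A x : qform A x = bform A x x. Proof. by []. Qed.

Lemma qformZx A (c : R) x : qform A (c *: x) = c ^+ 2 * qform A x.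
Proof. by rewrite qform_bform bformZl bformZr mulrA. Qed.

Lemma qform_add A x y : A^T = A ->
  qform A (x + y) = qform A x + 2 * bform A x y + qform A y.
Proof.
by move=> sA; rewrite !qform_bform !(bformDl, bformDr) (bformC y x sA); ring.
Qed.

Lemma bform_delta A x (j : 'I_g) : bform A x (delta_mx j 0) = \sum_i x i 0 * A i j.
Proof.
rewrite bformE; apply: eq_bigr => i _; rewrite (bigD1 j)//= big1 => [|k kj].
  by rewrite mxE !eqxx mulr1 addr0.
by rewrite mxE (negbTE kj) mulr0.
Qed.

Lemma bform_sumr A x y : bform A x y = \sum_j y j 0 * bform A x (delta_mx j 0).
Proof.
rewrite bformE exchange_big; apply: eq_bigr => j _.
by rewrite bform_delta mulr_sumr; apply: eq_bigr => i _; rewrite mulrC.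
Qed.

Lemma bform_delta2 A i j : bform A (delta_mx i 0) (delta_mx j 0) = A i j.
Proof.
rewrite bform_delta (bigD1 i)//= big1 => [|k ki].
  by rewrite mxE !eqxx mul1r addr0.
by rewrite mxE (negbTE ki) mul0r.
Qed.

Lemma bform_le A x y (C : R) : (forall i j, `|x i 0 * A i j * y j 0| <= C) ->
  `|bform A x y| <= (g * g)%:R * C.
Proof.
move=> H; rewrite bformE (le_trans (ler_norm_sum _ _ _))//.
apply: (@le_trans _ _ (\sum_(i < g) g%:R * C)).
  apply: ler_sum => i _; rewrite (le_trans (ler_norm_sum _ _ _))//.
  apply: (@le_trans _ _ (\sum_(j < g) C)); first exact: ler_sum.
  by rewrite sumr_const card_ord mulr_natl.
by rewrite sumr_const card_ord -[leLHS]mulr_natl natrM mulrA.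
Qed.

Definition psd A : Prop := forall x, 0 <= qform A x.

Lemma psd_qformD A x y : A^T = A -> psd A ->
  qform A (x + y) <= 2 * qform A x + 2 * qform A y.
Proof.
move=> sA pA; have := pA (x + -1 *: y); rewrite !qform_add// qformZx bformZr.
lra.
Qed.

End BilinearForms.

(** * Simultaneous Diophantine approximation *)

Section Dirichlet.
Variable R : realType.

Lemma dirichlet (g : nat) (x : 'I_g -> R) (K : nat) : (0 < K)%N ->
  exists q : nat, [/\ (0 < q)%N, (q <= K ^ g)%N &
    exists a : 'I_g -> int, forall i, `|q%:R * x i - (a i)%:~R| < K%:R^-1].
Proof.
case: K => // K _; set k := K.+1.
have k0 : 0 < k%:R :> R by rewrite ltr0n.
pose fr (q : nat) i : R := q%:R * x i - (Num.floor (q%:R * x i))%:~R.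
have fr01 q i : 0 <= fr q i < 1.
  by rewrite /fr subr_ge0 Num.Theory.floor_le /= ltrBlDl -[X in _ + X]/(1%:~R) -intrD
    Num.Theory.floorD1_gt.
pose cell (q : 'I_(k ^ g).+1) : {ffun 'I_g -> 'I_k} :=
  [ffun i => inord (Num.truncn (k%:R * fr q i))].
(* Pigeonhole: the fractional parts of [K^g + 1] multiples of [x] fall into [K^g] cubes of side
   [1/K]. The difference of two multiples in one cube is the required [q]. *)
have /injectivePn [q1 [q2 q12 E]] : ~~ injectiveb cell.
  apply/negP => /injectiveP /leq_card.
  by rewrite card_ffun !card_ord ltnn.
wlog lt12 : q1 q2 q12 E / (q1 < q2)%N.
  move=> H; case: (ltngtP q1 q2) => [|h|/val_inj h]; first exact: H.
    by apply: (H q2 q1) => //; rewrite eq_sym.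
  by rewrite h eqxx in q12.
exists (q2 - q1)%N; split.
- by rewrite subn_gt0.
- by rewrite (leq_trans (leq_subr _ _))// -ltnS.
exists (fun i => Num.floor (q2%:R * x i) - Num.floor (q1%:R * x i)) => i.
have tr q : (Num.truncn (k%:R * fr q i) < k)%N.
  have /andP[f0 f1] := fr01 q i.
  by rewrite truncn_lt_nat ?mulr_ge0 ?ler0n// gtr_pMr.
have E' : Num.truncn (k%:R * fr q1 i) = Num.truncn (k%:R * fr q2 i).
  move/ffunP/(_ i): E; rewrite !ffunE => /(congr1 val) /=.
  by rewrite !inordK ?tr.
have -> : (q2 - q1)%N%:R * x i - (Num.floor (q2%:R * x i) - Num.floor (q1%:R * x i))%:~R
    = fr q2 i - fr q1 i.
  by rewrite /fr natrB ?(ltnW lt12)// rmorphB/=; ring.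
have bnd q : (Num.truncn (k%:R * fr q i))%:R <= k%:R * fr q i <
             (Num.truncn (k%:R * fr q i)).+1%:R.
  by apply: truncn_itv; have /andP[f0 _] := fr01 q i; rewrite mulr_ge0 ?ler0n.
have := bnd q1; have := bnd q2; rewrite E' -natr1 => /andP[b1 b2] /andP[b3 b4].
rewrite -[ltRHS]mul1r ltr_pdivlMr// mulrC -{1}[k%:R]gtr0_norm// -normrM mulrBr.
by rewrite ltr_norml; apply/andP; split; lra.
Qed.

End Dirichlet.

(** * First consequences of the Minkowski inequalities *)

Section MinkowskiBound.
Variables (R : realType) (g : nat).

Lemma gcd_from_unit (k j : 'I_g) (a : 'cV[int]_g) : (k <= j)%N -> absz (a j 0) = 1%N ->
  gcd_from k a = 1%N.
Proof.
move=> kj aj; apply/eqP; rewrite -dvdn1 /gcd_from.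
by apply: (@biggcdn_inf _ j) => //; rewrite aj.
Qed.

Lemma gcd_from_scale (k : 'I_g) (a b : 'cV[int]_g) (s : nat) :
  (forall j : 'I_g, (k <= j)%N -> a j 0 = s%:Z * b j 0) ->
  gcd_from k a = (s * gcd_from k b)%N.
Proof.
move=> ab; rewrite /gcd_from.
rewrite (eq_bigr (fun j => muln s (absz (b j 0)))); last first.
  by move=> j kj; rewrite ab// abszM.
by apply/esym; apply: (big_morph (muln s)); [exact: muln_gcdr|rewrite muln0].
Qed.

Lemma gcd_from_gt0 (k j : 'I_g) (a : 'cV[int]_g) : (k <= j)%N -> a j 0 != 0 ->
  (0 < gcd_from k a)%N.
Proof.
move=> kj aj; rewrite lt0n; apply/eqP => H.
have : dvdn (gcd_from k a) (absz (a j 0)) by apply: (@biggcdn_inf _ j).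
by rewrite H dvd0n absz_eq0 (negbTE aj).
Qed.

Lemma gcd_from_dvd (k j : 'I_g) (a : 'cV[int]_g) : (k <= j)%N ->
  dvdn (gcd_from k a) (absz (a j 0)).
Proof. by move=> kj; apply: (@biggcdn_inf _ j). Qed.

Variable beta : 'M[R]_g.
Hypothesis coneb : minkowski_cone beta.
Hypothesis beta0 : forall k : 'I_g, k = 0%N :> nat -> 0 < beta k k.

Let sb : beta^T = beta. Proof. by case: coneb. Qed.

Lemma cone_diag_le (i j : 'I_g) : (i <= j)%N -> beta i i <= beta j j.
Proof.
move=> ij; have [_ _ /(_ i (delta_mx j 0)) H _] := coneb.
have : minkowski_ineq beta i (delta_mx j 0).
  by apply/H/(gcd_from_unit ij); rewrite mxE !eqxx.
by rewrite /minkowski_ineq map_delta_mx qform_bform bform_delta2.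
Qed.

Lemma cone_diag_gt0 (i : 'I_g) : 0 < beta i i.
Proof.
have i0 : (0 < g)%N by case: (g) i => // -[].
by apply: lt_le_trans (beta0 (k := Ordinal i0) erefl) (cone_diag_le _).
Qed.

(** The Minkowski inequalities at [j] for the vectors [e_j + e_i] and [e_j - e_i] even bound
    [2 |beta i j|] by [beta i i]. *)
Lemma cone_offdiag_lt (i j : 'I_g) : (i < j)%N -> `|beta i j| <= beta i i.
Proof.
move=> ij; have [_ _ H _] := coneb.
have nij : j != i by apply/eqP => E; rewrite E ltnn in ij.
have key (s : int) : minkowski_ineq beta j (delta_mx j 0 + s *: delta_mx i 0).
  apply/H/(gcd_from_unit (leqnn j)).
  by rewrite !mxE !eqxx (negbTE nij) /= mulr0 addr0.
have q (s : int) : beta j j <= beta j j + 2 * s%:~R * beta i j + s%:~R ^+ 2 * beta i i.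
  have := key s; rewrite /minkowski_ineq map_mxD map_mxZ !map_delta_mx.
  rewrite qform_add// qformZx bformZr !qform_bform !bform_delta2.
  have -> : beta j i = beta i j by have /matrixP/(_ i j) := sb; rewrite mxE.
  by rewrite mulrA.
have := q 1; have := q (-1); have := cone_diag_gt0 i.
rewrite rmorphN rmorph1 sqrrN expr1n ler_norml => ? ? ?.
by apply/andP; split; lra.
Qed.

Lemma cone_offdiag (i j : 'I_g) : `|beta i j| <= beta i i.
Proof.
case: (ltngtP i j) => [|ji|/val_inj ->]; first exact: cone_offdiag_lt.
  have -> : beta i j = beta j i by have /matrixP/(_ j i) := sb; rewrite mxE.
  by apply: le_trans (cone_offdiag_lt ji) (cone_diag_le _); exact: ltnW.
by rewrite ger0_norm// ltW// cone_diag_gt0.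
Qed.

Lemma cone_offdiagr (i j : 'I_g) : `|beta i j| <= beta j j.
Proof.
have -> : beta i j = beta j i by have /matrixP/(_ j i) := sb; rewrite mxE.
exact: cone_offdiag.
Qed.

Lemma cone_qform_int_ge0 (a : 'cV[int]_g) : 0 <= qform beta (map_mx intr a).
Proof.
have [->|] := eqVneq a 0.
  by rewrite map_mx0 qform_bform bformE big1// => i _; rewrite big1// => j _;
    rewrite !mxE !mul0r.
move=> /eqP/matrixP a0.
have [j aj] : exists j, a j 0 != 0.
  apply: contrapT => H; apply: a0 => j k; rewrite ord1 mxE.
  by apply: contrapT => /eqP aj; apply: H; exists j.
have i0 : (0 < g)%N := leq_ltn_trans (leq0n j) (ltn_ord j).
pose k := Ordinal i0; pose s := gcd_from k a.
have s0 : (0 < s)%N by apply: (gcd_from_gt0 (j := j)).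
pose b : 'cV[int]_g := \col_l divz (a l 0) s.
have ab l : a l 0 = s%:Z * b l 0.
  by rewrite mxE mulrC divzK// dvdzE/= gcd_from_dvd.
have bk : gcd_from k b = 1%N.
  apply/eqP; rewrite -(eqn_pmul2l s0) muln1 -(@gcd_from_scale _ a)//.
have -> : map_mx intr a = (s%:R : R) *: map_mx intr b.
  by apply/matrixP => l z; rewrite ord1 [LHS]mxE ab rmorphM [RHS]mxE [in RHS]mxE.
rewrite qformZx mulr_ge0 ?sqr_ge0//.
have [_ _ /(_ k b bk) H _] := coneb.
by apply: le_trans H; rewrite ltW// cone_diag_gt0.
Qed.

(** Nonnegativity passes from integral to real vectors: rounding [N x] changes the form by terms at
    most linear in [N], which cannot compensate a negative [N^2 qform beta x] for large [N]. *)
Lemma cone_psd : psd beta.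
Proof.
move=> x; rewrite leNgt; apply/negP => q0.
pose X := \sum_i `|x i 0|; pose B := \sum_i beta i i.
have xX i : `|x i 0| <= X by rewrite /X (bigD1 i)//= lerDl sumr_ge0.
have bB i j : `|beta i j| <= B.
  rewrite (le_trans (cone_offdiag i j))// /B (bigD1 i)//= lerDl sumr_ge0// => k _.
  by rewrite ltW// cone_diag_gt0.
have B0 : 0 <= B by apply: sumr_ge0 => k _; rewrite ltW// cone_diag_gt0.
have X0 : 0 <= X by apply: sumr_ge0.
pose C := (g * g)%:R * (X * B); pose D := (g * g)%:R * B.
have C0 : 0 <= C by rewrite !mulr_ge0.
have D0 : 0 <= D by rewrite !mulr_ge0.
pose N := (Num.bound ((2 * C + D) / - qform beta x)).+1.
have HN : (2 * C + D) / - qform beta x < N%:R.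
  have pos : 0 <= (2 * C + D) / - qform beta x.
    by rewrite divr_ge0 ?addr_ge0 ?mulr_ge0// oppr_ge0 ltW.
  by rewrite (lt_le_trans (archi_boundP pos))// ler_nat.
rewrite ltr_pdivrMr ?oppr_gt0// in HN.
pose k : 'cV[int]_g := \col_i Num.floor (N%:R * x i 0).
pose e : 'cV[R]_g := \col_i ((Num.floor (N%:R * x i 0))%:~R - N%:R * x i 0).
have e1 i : `|e i 0| <= 1.
  rewrite mxE ler_norml; have := Num.Theory.floor_itv (N%:R * x i 0).
  rewrite intrD => /andP[? ?]; apply/andP; split; lra.
have kE : map_mx intr k = N%:R *: x + e.
  by apply/matrixP => i z; rewrite ord1 !mxE addrC subrK.
have := cone_qform_int_ge0 k; rewrite kE qform_add// qformZx bformZl.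
have h1 : `|bform beta x e| <= C.
  apply: bform_le => i j; rewrite !normrM -[leRHS]mulr1.
  by apply: ler_pM => //; rewrite ?mulr_ge0//; exact: ler_pM.
have h2 : `|qform beta e| <= D.
  apply: bform_le => i j; rewrite !normrM -[leRHS]mulr1 -[B]mul1r.
  by apply: ler_pM => //; rewrite ?mulr_ge0//; exact: ler_pM.
move: h1 h2; rewrite !ler_norml => /andP[_ h1] /andP[_ h2].
have N1 : 1 <= N%:R :> R by rewrite ler1n.
set n := N%:R in HN N1 *; set q := qform beta x in q0 HN *.
apply/negP; rewrite -ltNge.
have : n ^+ 2 * q + 2 * n * C + D <= n * (n * q + (2 * C + D)) by nra.
have : n * (n * q + (2 * C + D)) < 0 by rewrite pmulr_rlt0//; nra.
nra.
Qed.

End MinkowskiBound.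

(** * Uniform coercivity on the Minkowski cone *)

Section MinkowskiCoercivity.
Variable R : realType.

(** For [h] the last index up to [n] with [b (h - 1) <= eps b h], or 0 if there is none, each later
    step loses less than a factor [eps], and monotonicity spreads the gap at [h] to all smaller
    indices. *)
Lemma exists_gap (eps : R) (b : nat -> R) (n : nat) : 0 <= eps -> eps <= 1 ->
  (forall i j, (i <= j <= n)%N -> b i <= b j) -> (forall i, 0 <= b i) ->
  exists h, [/\ (h <= n)%N, eps ^+ n * b n <= b h &
    forall l, (l < h)%N -> b l <= eps * b h].
Proof.
move=> e0 e1; elim: n => [|n IH] mon b0; first by exists 0%N; rewrite expr0 mul1r.
have [bn|bn] := leP (b n) (eps * b n.+1).
  exists n.+1; split => //; first by rewrite ler_piMl// exprn_ile1.
  by move=> l ln; rewrite (le_trans _ bn)// mon// -ltnS ln leqnSn.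
have [i j /andP[ij jn]|//|h [hn bh hl]] := IH.
  by apply: mon; rewrite ij (leqW jn).
exists h; split => //; first exact: leqW.
rewrite (le_trans _ bh)// exprSr -mulrA ler_wpM2l ?exprn_ge0//.
exact: ltW.
Qed.

(* With [h] the last index at which the diagonal jumps by a factor [1/eps], an
   integer approximation [a] of a multiple of [x] is divided by the gcd of its
   entries of index at least [h]; rounding the other entries costs only
   [O(eps) beta_hh], and the Minkowski inequality at [h] applies. *)
Lemma minkowski_key (g : nat) (n : 'I_g) : exists2 c : R, 0 < c &
  forall beta : 'M[R]_g, minkowski_cone beta ->
  (forall k : 'I_g, k = 0%N :> nat -> 0 < beta k k) ->
  forall x : 'cV[R]_g, (forall i : 'I_g, (n < i)%N -> x i 0 = 0) ->
  c * beta n n * x n 0 ^+ 2 <= qform beta x.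
Proof.
have g0 : (0 < g)%N := leq_ltn_trans (leq0n n) (ltn_ord n).
pose G : R := (g * g)%:R.
have G1 : 1 <= G by rewrite /G ler1n muln_gt0 g0.
(* The estimate at the end is [bb <= 4 Q^2 q(x) + bb/4 + bb/4]. This [eps] makes the cost of
   rounding the entries below [h] equal to [bb/4], and [K] below does the same for the error of the
   Dirichlet approximation. *)
pose eps : R := (8 * G)^-1.
have eps0 : 0 < eps by rewrite invr_gt0; lra.
have epsG : eps * G = 8^-1 by rewrite /eps invfM mulfVK// gt_eqF// (lt_le_trans ltr01).
have eps1 : eps <= 1 by nra.
pose E := eps ^+ n.
have E0 : 0 < E by rewrite exprn_gt0.
pose K := (Num.bound (16 * G / E)).+2.
have K2 : 2 <= K%:R :> R by rewrite ler_nat.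
have KE : 16 * G <= K%:R * E.
  rewrite -ler_pdivrMr// ltW//.
  have pos : 0 <= 16 * G / E by rewrite divr_ge0 ?(ltW E0)//; lra.
  by rewrite (lt_le_trans (archi_boundP pos))// ler_nat leqW// leqW.
pose Q : R := (K ^ g)%:R.
have Q1 : 1 <= Q by rewrite /Q ler1n expn_gt0.
exists (E / (8 * Q ^+ 2)); first by rewrite divr_gt0// mulr_gt0// exprn_gt0; lra.
move=> beta cb b0.
have sb : beta^T = beta by case: cb.
have ps := cone_psd cb b0.
(* Normalising [x n 0] to 1 puts [a n] within 1/2 of the positive integer [q], so [a n] is nonzero
   and the gcd [s] is positive. *)
suff key (x : 'cV[R]_g) : (forall i : 'I_g, (n < i)%N -> x i 0 = 0) -> x n 0 = 1 ->
    E * beta n n <= 8 * Q ^+ 2 * qform beta x.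
  move=> x xs; have [->|xn] := eqVneq (x n 0) 0.
    by rewrite expr0n mulr0; exact: ps.
  have := key ((x n 0)^-1 *: x); rewrite mxE mulVf// => /(_ _ erefl) H.
  have {H} : E * beta n n <= 8 * Q ^+ 2 * qform beta ((x n 0)^-1 *: x).
    by apply: H => i ni; rewrite mxE (xs i ni) mulr0.
  rewrite qformZx exprVn [_^-1 * _]mulrC mulrA ler_pdivlMr; last by rewrite exprn_even_gt0.
  have Q8 : 0 < 8 * Q ^+ 2 by rewrite mulr_gt0// exprn_gt0; lra.
  move=> H; have -> : E / (8 * Q ^+ 2) * beta n n * x n 0 ^+ 2 =
      E * beta n n * x n 0 ^+ 2 / (8 * Q ^+ 2) by move: (_^-1) => z; ring.
  by rewrite ler_pdivrMr// [qform _ _ * _]mulrC.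
move=> xs xn.
pose b k := beta (insubd n k) (insubd n k).
have bE (i : 'I_g) : b i = beta i i by rewrite /b valKd.
have bn : b n = beta n n := bE n.
have [||h [hn bh hl]] := @exists_gap eps b n (ltW eps0) eps1.
- move=> i j /andP[ij jn].
  have jg : (j < g)%N := leq_ltn_trans jn (ltn_ord n).
  have ig : (i < g)%N := leq_ltn_trans ij jg.
  by rewrite (bE (Ordinal ig)) (bE (Ordinal jg)); apply: cone_diag_le.
- by move=> i; rewrite ltW// cone_diag_gt0.
pose ho := Ordinal (leq_ltn_trans hn (ltn_ord n)).
have bho : b h = beta ho ho := bE ho.
rewrite bn bho in bh.
have {}hl (l : 'I_g) : (l < h)%N -> beta l l <= eps * beta ho ho.
  by rewrite -bE -bho; exact: hl.
set bb := beta ho ho in bh hl; have bb0 : 0 < bb by rewrite cone_diag_gt0.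
have [q [q0 qK [a aP]]] := dirichlet (fun i => x i 0) (ltn0Sn (Num.bound (16 * G / E)).+1).
rewrite -/K in aP qK.
have K0 : 0 < K%:R :> R by rewrite ltr0n.
have K1 : K%:R^-1 <= 2^-1 :> R by rewrite lef_pV2 ?posrE.
pose av : 'cV[int]_g := \col_i a i.
pose e : 'cV[R]_g := map_mx intr av - q%:R *: x.
have eK i : `|e i 0| <= K%:R^-1 by rewrite !mxE distrC ltW// aP.
have az (i : 'I_g) : (n < i)%N -> a i = 0.
  move=> ni; apply/eqP; rewrite -absz_eq0 -leqn0 -ltnS -(ltr_nat R).
  have := aP i; rewrite (xs i ni) mulr0 add0r normrN -intr_norm => H.
  by rewrite natr_absz (lt_trans H)// (le_lt_trans K1)//; lra.
have es (i : 'I_g) : (n < i)%N -> e i 0 = 0.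
  by move=> ni; rewrite !mxE (az i ni) (xs i ni) mulr0 subr0.
have an : a n != 0.
  apply/eqP => an0; have := aP n; rewrite an0 xn mulr1 subr0 normr_nat.
  have : 1 <= q%:R :> R by rewrite ler1n.
  lra.
have qe : qform beta e <= G * (beta n n / K%:R).
  apply: le_trans (ler_norm _) _; apply: bform_le => i j.
  have [ni|ni] := ltnP n i.
    by rewrite es// !mul0r normr0 divr_ge0 ?ltW// cone_diag_gt0.
  rewrite !normrM [leRHS]mulrC -[beta n n]mulr1 mulrA; apply: ler_pM; rewrite ?mulr_ge0//.
    apply: ler_pM => //; apply: le_trans (cone_offdiag cb b0 i j) _.
    exact: cone_diag_le.
  by rewrite (le_trans (eK j))//; lra.
have qa : qform beta (map_mx intr av) <= 2 * (Q ^+ 2 * qform beta x) + 2 * (G * (beta n n / K%:R)).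
  have -> : map_mx intr av = q%:R *: x + e by rewrite /e addrC subrK.
  rewrite (le_trans (psd_qformD _ _ sb ps))// qformZx lerD// ler_pM2l//.
  by apply: ler_wpM2r; [exact: ps|rewrite /Q lerXn2r ?nnegrE ?ler0n// ler_nat].
pose s := gcd_from ho av.
have s0 : (0 < s)%N by apply: (gcd_from_gt0 (j := n)) => //; rewrite mxE.
have sR : 1 <= s%:R :> R by rewrite ler1n.
pose a' : 'cV[int]_g := \col_i divz (a i) s.
pose rr : 'cV[R]_g := \col_i (- (modz (a i) s)%:~R / s%:R).
have a'E : map_mx intr a' = s%:R^-1 *: map_mx intr av + rr.
  apply/matrixP => i z; rewrite ord1 !mxE {2}(divz_eq (a i) s) intrD intrM.
  by rewrite -pmulrn; field; rewrite gt_eqF// ltr0n.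
have gcd1 : gcd_from ho a' = 1%N.
  apply/eqP; rewrite -(eqn_pmul2l s0) muln1 -(@gcd_from_scale _ _ av)// => j hj.
  rewrite !mxE mulrC divzK// dvdzE /=.
  by have := gcd_from_dvd av hj; rewrite mxE.
have rr1 i : `|rr i 0| <= 1.
  rewrite mxE mulNr normrN ger0_norm; last first.
    by rewrite divr_ge0// ler0z modz_ge0// -lt0n.
  rewrite ler_pdivrMr ?mul1r; last by rewrite ltr0n.
  by rewrite pmulrn ler_int ltW// ltz_mod// -lt0n.
(* The gcd divides every entry of index at least [h], so the remainders live where the diagonal is
   at most [eps * bb]. *)
have rrs (i : 'I_g) : (h <= i)%N -> rr i 0 = 0.
  move=> hi; have := @gcd_from_dvd _ ho i av hi; rewrite !mxE => H.
  have /dvdz_mod0P -> : (s %| a i)%Z by rewrite dvdzE.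
  by rewrite oppr0 mul0r.
have qr : qform beta rr <= G * (eps * bb).
  apply: le_trans (ler_norm _) _; apply: bform_le => i j.
  have [hi|hi] := leqP h i.
    by rewrite rrs// !mul0r normr0 mulr_ge0// ltW.
  rewrite !normrM -[leRHS]mulr1; apply: ler_pM; rewrite ?mulr_ge0//.
  rewrite -[leRHS]mul1r; apply: ler_pM => //.
  exact: le_trans (cone_offdiag cb b0 i j) (hl i hi).
have fin : bb <= 2 * qform beta (map_mx intr av) + 2 * (G * (eps * bb)).
  have [_ _ /(_ ho a' gcd1) H _] := cb; apply: le_trans H _.
  rewrite a'E (le_trans (psd_qformD _ _ sb ps))// lerD// ?ler_pM2l//.
  rewrite qformZx ler_piMl ?ps// exprVn invf_le1 ?exprn_gt0 ?ltr0n//.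
  by rewrite exprn_ege1.
have hK : G * (beta n n / K%:R) <= bb / 16.
  rewrite mulrA ler_pdivrMr//.
  suff : 16 * G * beta n n <= K%:R * bb by lra.
  have := cone_diag_gt0 cb b0 n => bn0.
  have : 16 * G * beta n n <= K%:R * E * beta n n by rewrite ler_wpM2r// ltW.
  have : K%:R * (E * beta n n) <= K%:R * bb by rewrite ler_wpM2l// ltW.
  lra.
have hG : G * (eps * bb) = bb / 8 by rewrite mulrA [G * _]mulrC epsG mulrC.
by rewrite hG in fin; rewrite (le_trans bh)// -mulrA; lra.
Qed.
(** Induction on the support of [x]: [minkowski_key] controls the last coordinate, and removing it
    multiplies the value of the form by at most [2 + 2 / c1]. *)
Lemma minkowski_coercive (g : nat) : exists2 c : R, 0 < c &
  forall beta : 'M[R]_g, minkowski_cone beta ->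
  (forall k : 'I_g, k = 0%N :> nat -> 0 < beta k k) ->
  forall (x : 'cV[R]_g) i, c * beta i i * x i 0 ^+ 2 <= qform beta x.
Proof.
suff H (n : nat) : exists2 c : R, 0 < c &
    forall beta : 'M[R]_g, minkowski_cone beta ->
    (forall k : 'I_g, k = 0%N :> nat -> 0 < beta k k) ->
    forall x : 'cV[R]_g, (forall i : 'I_g, (n <= i)%N -> x i 0 = 0) ->
    forall i, c * beta i i * x i 0 ^+ 2 <= qform beta x.
  have [c c0 cP] := H g; exists c => // beta cb b0 x; apply: cP => // i.
  by rewrite leqNgt ltn_ord.
elim: n => [|n [c c0 cP]].
  exists 1 => // beta cb b0 x x0 i; rewrite x0// expr0n mulr0.
  exact: cone_psd cb b0 x.
have [ng|gn] := ltnP n g; last first.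
  exists c => // beta cb b0 x _; apply: cP => // i ni.
  by have := leq_trans gn ni; rewrite leqNgt ltn_ord.
pose no := Ordinal ng; have [c1 c10 c1P] := minkowski_key no.
pose c2 := c / (2 + 2 / c1).
have d0 : 0 < 2 + 2 / c1 by rewrite addr_gt0// divr_gt0.
have c20 : 0 < c2 by rewrite divr_gt0.
exists (Num.min c1 c2); first by rewrite lt_min c10 c20.
move=> beta cb b0 x xs i.
have bi0 := cone_diag_gt0 cb b0 i.
have sb : beta^T = beta by case: cb.
have ps := cone_psd cb b0.
have bx0 : 0 <= beta i i * x i 0 ^+ 2 by rewrite mulr_ge0 ?sqr_ge0// ltW.
have xn : c1 * beta no no * x no 0 ^+ 2 <= qform beta x by apply: c1P.
have [i_no|ni] := eqVneq i no.
  rewrite -mulrA; subst i; apply: le_trans xn; rewrite -mulrA.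
  by rewrite ler_wpM2r// ge_min lexx.
rewrite -mulrA; apply: (@le_trans _ _ (c2 * (beta i i * x i 0 ^+ 2))).
  by rewrite ler_wpM2r// ge_min lexx orbT.
pose y := x + (- x no 0) *: delta_mx no 0.
have yi : y i 0 = x i 0 by rewrite !mxE (negbTE ni) mulr0 addr0.
have ys (j : 'I_g) : (n <= j)%N -> y j 0 = 0.
  rewrite leq_eqVlt => /orP[/eqP nj|nj].
    have -> : j = no by apply: val_inj.
    by rewrite !mxE !eqxx mulr1 subrr.
  have jn : j != no by apply/eqP => E; rewrite E /= ltnn in nj.
  by rewrite !mxE (xs j nj) (negbTE jn) mulr0 addr0.
have := cP beta cb b0 y ys i; rewrite yi => Hy.
have qy : qform beta y <= 2 * qform beta x + 2 * (beta no no * x no 0 ^+ 2).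
  rewrite (le_trans (psd_qformD _ _ sb ps))// qformZx sqrrN.
  rewrite (_ : qform beta (delta_mx no 0) = beta no no); last exact: bform_delta2.
  by rewrite [x no 0 ^+ 2 * _]mulrC.
have h : beta no no * x no 0 ^+ 2 <= qform beta x / c1.
  by rewrite ler_pdivlMr// mulrC mulrA.
rewrite /c2 mulrAC ler_pdivrMr//.
have -> : qform beta x * (2 + 2 / c1) = 2 * qform beta x + 2 * (qform beta x / c1).
  by move: (c1^-1) => z; ring.
by lra.
Qed.

End MinkowskiCoercivity.

(** * Rounded Gram-Schmidt reduction *)

Section ReducedBasis.
Variables (R : realType) (g : nat) (c : R).
Hypothesis c0 : 0 < c.

Record coercive (beta : 'M[R]_g) : Prop := Coercive {
  coer_sym : beta^T = beta;
  coer_gt0 : forall i, 0 < beta i i;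
  coer_mono : forall i j : 'I_g, (i <= j)%N -> beta i i <= beta j j;
  coer_off : forall i j : 'I_g, `|beta i j| <= beta j j;
  coer_q : forall (x : 'cV[R]_g) i, c * beta i i * x i 0 ^+ 2 <= qform beta x }.

Lemma quadratic_bound (a D : R) : 0 <= D ->
  c * a ^+ 2 <= D * a + g%:R * (D ^+ 2 / (4 * c)) -> a <= (1 + g%:R) * D / c.
Proof.
move=> D0 H; rewrite leNgt; apply/negP; rewrite ltr_pdivrMr// => h.
have gp : 0 <= g%:R :> R by rewrite ler0n.
have H' : (a * c) ^+ 2 <= D * (a * c) + g%:R * D ^+ 2 / 4.
  have -> : (a * c) ^+ 2 = c * (c * a ^+ 2) by ring.
  have -> : D * (a * c) + g%:R * D ^+ 2 / 4 = c * (D * a + g%:R * (D ^+ 2 / (4 * c))).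
    by field; rewrite gt_eqF.
  by rewrite ler_pM2l.
move: (a * c) h H' => X h H'.
have X0 : 0 < X by apply: le_lt_trans h; rewrite mulr_ge0// addr_ge0.
have h1 : (1 + g%:R) * D * X < X ^+ 2 by rewrite expr2 ltr_pM2r.
have h2 : D <= X by nra.
have h3 : 0 <= g%:R * D by rewrite mulr_ge0.
have h4 : g%:R * D * D <= g%:R * D * X by rewrite ler_wpM2l.
have h5 : 0 <= g%:R * D ^+ 2 by rewrite mulr_ge0 ?sqr_ge0.
nra.
Qed.

(* The coordinates are bounded from the last one down: a direct estimate only
   gives [beta_ll v_l^2 = O(beta_nn)], which is weak for small [l]. *)
Lemma coercive_solution_bounded (n : nat) : forall b : R, 0 <= b ->
  exists2 B : R, 0 <= B & forall beta, coercive beta -> forall v : 'cV[R]_g,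
    (forall l : 'I_g, (n <= l)%N -> v l 0 = 0) ->
    (forall j : 'I_g, (j < n)%N -> `|bform beta v (delta_mx j 0)| <= b * beta j j) ->
    forall l, `|v l 0| <= B.
Proof.
elim: n => [|n IH] b b0.
  by exists 0 => // beta _ v v0 _ l; rewrite v0// normr0.
have [ng|gn] := ltnP n g; last first.
  have [B B0 BP] := IH b b0; exists B => // beta cb v vs vb l.
  apply: (BP beta cb v) => [j nj|j jn].
    by have := leq_trans gn nj; rewrite leqNgt ltn_ord.
  by apply: vb; exact: leqW.
pose t := Ordinal ng; pose D := g%:R * b; pose B0 := (1 + g%:R) * D / c.
have D0 : 0 <= D by rewrite mulr_ge0.
have B00 : 0 <= B0 by rewrite divr_ge0 ?(ltW c0)// mulr_ge0// addr_ge0.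
have [B Bp BP] := IH (b + B0) (addr_ge0 b0 B00).
exists (B + B0); first exact: addr_ge0.
move=> beta cb v vs vb.
have bt0 := coer_gt0 cb t.
have vt : `|v t 0| <= B0.
  apply: quadratic_bound => //; rewrite real_normK ?num_real//.
  (* Summing the coercivity estimates over all [l] makes the total of [f] nonpositive. Completing
     the square bounds each [f l] below by a multiple of [beta t t], as the diagonal is
     nondecreasing; what remains for [l = t] is a quadratic inequality from which [beta t t]
     cancels. *)
  pose f l := beta l l * (c * v l 0 ^+ 2 - D * `|v l 0|).
  have qv : qform beta v <= \sum_l b * beta l l * `|v l 0|.
    rewrite qform_bform bform_sumr; apply: ler_sum => l _.
    rewrite (le_trans (ler_norm _))// normrM mulrC.
    have [ln|nl] := ltnP l n.+1; first by rewrite ler_wpM2r// vb.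
    by rewrite vs// normr0 !mulr0.
  have fs : \sum_l f l <= 0.
    have -> : \sum_l f l = \sum_l c * beta l l * v l 0 ^+ 2 -
        g%:R * \sum_l b * beta l l * `|v l 0|.
      by rewrite mulr_sumr -sumrB; apply: eq_bigr => l _; rewrite /f /D; ring.
    have : \sum_l c * beta l l * v l 0 ^+ 2 <= \sum_(l < g) qform beta v.
      by apply: ler_sum => l _; exact: coer_q.
    rewrite sumr_const card_ord -[X in _ <= X -> _]mulr_natl => h.
    by rewrite subr_le0 (le_trans h)// ler_wpM2l.
  have fl l : - (beta t t * (D ^+ 2 / (4 * c))) <= f l.
    have [ln|nl] := ltnP l n.+1; last first.
      rewrite /f vs// normr0 expr0n !mulr0 subr0 mulr0 oppr_le0.
      by rewrite mulr_ge0 ?(ltW bt0)// divr_ge0 ?sqr_ge0// mulr_ge0// ltW.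
    have h : - (D ^+ 2 / (4 * c)) <= c * v l 0 ^+ 2 - D * `|v l 0|.
      have -> : v l 0 ^+ 2 = `|v l 0| ^+ 2 by rewrite real_normK ?num_real.
      rewrite -subr_ge0.
      have -> : c * `|v l 0| ^+ 2 - D * `|v l 0| - - (D ^+ 2 / (4 * c)) =
        c * (`|v l 0| - D / (2 * c)) ^+ 2 by field; rewrite gt_eqF.
      by rewrite mulr_ge0 ?sqr_ge0// ltW.
    have bl0 := coer_gt0 cb l.
    have : beta l l * - (D ^+ 2 / (4 * c)) <= f l by rewrite /f ler_pM2l.
    apply: le_trans; rewrite mulrN lerN2 ler_wpM2r//.
      by rewrite divr_ge0 ?sqr_ge0// mulr_ge0// ltW.
    by apply: coer_mono => //; rewrite -ltnS.
  have : f t <= g%:R * (beta t t * (D ^+ 2 / (4 * c))).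
    have := fs; rewrite (bigD1 t)//=.
    have : \sum_(l < g | l != t) - (beta t t * (D ^+ 2 / (4 * c))) <= \sum_(l < g | l != t) f l.
      by apply: ler_sum => l _.
    rewrite sumr_const => h1 h2.
    have : #|[pred l : 'I_g | l != t]|%:R <= g%:R :> R.
      by rewrite ler_nat (leq_trans (max_card _))// card_ord.
    have : 0 <= beta t t * (D ^+ 2 / (4 * c)).
      by rewrite mulr_ge0 ?(ltW bt0)// divr_ge0 ?sqr_ge0// mulr_ge0// ltW.
    move: h1; rewrite -[X in X <= _ -> _]mulr_natl.
    move: (beta t t * _) => y h1 y0 hc; nra.
  by rewrite /f [g%:R * _]mulrCA ler_pM2l// => ?; lra.
(* Removing coordinate [t] changes the pairing with [e_j] by at most [B0 * beta j j]; hence the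
   induction hypothesis was taken at [b + B0]. *)
pose v' := v + (- v t 0) *: delta_mx t 0.
have vs' (l : 'I_g) : (n <= l)%N -> v' l 0 = 0.
  rewrite leq_eqVlt => /orP[/eqP nl|nl].
    have -> : l = t by apply: val_inj.
    by rewrite !mxE !eqxx mulr1 subrr.
  have lt : l != t by apply/eqP => E; rewrite E /= ltnn in nl.
  by rewrite !mxE (vs l nl) (negbTE lt) mulr0 addr0.
have H l : `|v' l 0| <= B.
  apply: (BP beta cb v' vs') => j jn.
  rewrite bformDl bformZl bform_delta2 mulrDl (le_trans (ler_normD _ _))// lerD//.
    by apply: vb; exact: leqW.
  by rewrite normrM normrN ler_pM// coer_off.
move=> l; have [->|lt] := eqVneq l t; first by rewrite (le_trans vt)// lerDr.
have -> : v l 0 = v' l 0 by rewrite !mxE (negbTE lt) mulr0 addr0.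
by rewrite (le_trans (H l))// lerDl.
Qed.

(** [v] is the beta-orthogonal projection of [e_i] onto the span of the earlier basis vectors. It
    exists because coercivity makes the leading block of [beta] nondegenerate. *)
Lemma coercive_projection (beta : 'M[R]_g) (i : 'I_g) : coercive beta ->
  exists v : 'cV[R]_g, (forall l : 'I_g, (i <= l)%N -> v l 0 = 0) /\
    forall j : 'I_g, (j < i)%N -> bform beta v (delta_mx j 0) = beta i j.
Proof.
move=> cb.
(* The leading block is completed by an identity block, which avoids matrices of varying size. *)
pose M : 'M[R]_g := \matrix_(j, l)
  if (j < i)%N && (l < i)%N then beta j l else (j == l)%:R.
have rowM (u : 'rV[R]_g) (l : 'I_g) : (i <= l)%N -> (u *m M) 0 l = u 0 l.
  move=> il; rewrite mxE (bigD1 l)//= big1 => [|j jl].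
    by rewrite mxE ltnNge il andbF eqxx mulr1 addr0.
  by rewrite mxE [(l < i)%N]ltnNge il andbF (negbTE jl) mulr0.
have rowM' (u : 'rV[R]_g) (l : 'I_g) : (l < i)%N ->
    (forall j : 'I_g, (i <= j)%N -> u 0 j = 0) ->
    (u *m M) 0 l = bform beta u^T (delta_mx l 0).
  move=> li us; rewrite mxE bform_delta; apply: eq_bigr => j _; rewrite !mxE li andbT.
  by have [//|ij] := ltnP j i; rewrite us// !mul0r.
have uM : M \in unitmx.
  rewrite -row_free_unit; apply: inj_row_free => u uM0.
  have us (j : 'I_g) : (i <= j)%N -> u 0 j = 0.
    by move=> ij; rewrite -(rowM u)// uM0 mxE.
  have q0 : qform beta u^T = 0.
    rewrite qform_bform bform_sumr big1// => l _; rewrite mxE.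
    have [li|il] := ltnP l i; last by rewrite us// mul0r.
    by rewrite -rowM'// uM0 mxE mulr0.
  apply/matrixP => z j; rewrite ord1 mxE; apply/eqP; rewrite -sqrf_eq0.
  have := coer_q cb u^T j; rewrite q0 mxE pmulr_rle0; last first.
    by rewrite mulr_gt0// coer_gt0.
  by move=> h; rewrite eq_le h sqr_ge0.
pose r : 'rV[R]_g := \row_l if (l < i)%N then beta i l else 0.
pose v := r *m invmx M.
have vM : v *m M = r by rewrite /v mulmxKV.
have vs (j : 'I_g) : (i <= j)%N -> v 0 j = 0.
  by move=> ij; rewrite -(rowM v)// vM mxE ltnNge ij.
exists v^T; split=> [l il|j ji]; first by rewrite mxE vs.
by rewrite -rowM'// vM mxE ji.
Qed.

(* The columns of [W] are [N] times the Gram-Schmidt vectors, rounded. *)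
Lemma reduced_basis : exists2 B : R, 0 <= B &
  forall (N : nat), (0 < N)%N -> forall beta, coercive beta ->
  exists W : 'M[int]_g,
  [/\ forall l i : 'I_g, (i < l)%N -> W l i = 0,
      forall i, W i i = N,
      forall l i, `|(W l i)%:~R| <= N%:R * (B + 2) &
      forall i j : 'I_g, (j < i)%N ->
        `|bform beta (col i (map_mx intr W)) (col j (map_mx intr W))|
          <= (g * g)%:R * (N%:R * (B + 2) * beta j j)].
Proof.
have [Bn BnP] := @choice _ _ (fun (n : 'I_g) (B : R) => 0 <= B /\
    forall beta, coercive beta -> forall v : 'cV[R]_g,
    (forall l : 'I_g, (n <= l)%N -> v l 0 = 0) ->
    (forall j : 'I_g, (j < n)%N -> `|bform beta v (delta_mx j 0)| <= 1 * beta j j) ->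
    forall l, `|v l 0| <= B) (fun n =>
      let: ex_intro2 B B0 BP := coercive_solution_bounded n ler01 in
      ex_intro _ B (conj B0 BP)).
pose B : R := \sum_n Bn n.
have B0 : 0 <= B by apply: sumr_ge0 => n _; have [] := BnP n.
have BnB n : Bn n <= B.
  by rewrite /B (bigD1 n)//= lerDl sumr_ge0// => k _; have [] := BnP k.
exists B => // N N0 beta cb.
have N1 : 1 <= N%:R :> R by rewrite ler1n.
have [v vP] := @choice _ _ _ (fun i => coercive_projection i cb).
have vs (i l : 'I_g) : (i <= l)%N -> v i l 0 = 0 by case: (vP i) => + _; apply.
have vb (i j : 'I_g) : (j < i)%N -> bform beta (v i) (delta_mx j 0) = beta i j.
  by case: (vP i) => _; apply.
have vB (i l : 'I_g) : `|v i l 0| <= B.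
  apply: le_trans (BnB i); have [_] := BnP i; apply; first exact: cb.
    exact: vs.
  by move=> j ji; rewrite vb// mul1r coer_off.
pose W : 'M[int]_g := \matrix_(l, i) ((if l == i then N%:Z else 0) - Num.floor (N%:R * v i l 0)).
exists W.
have W0 (l i : 'I_g) : (i < l)%N -> W l i = 0.
  move=> il; rewrite mxE vs ?(ltnW il)// mulr0 floor0 subr0.
  by case: eqP => // E; rewrite E ltnn in il.
have WN i : W i i = N by rewrite mxE eqxx vs// mulr0 floor0 subr0.
pose u (i : 'I_g) : 'cV[R]_g := col i (map_mx intr W).
pose er (i : 'I_g) : 'cV[R]_g := \col_l (N%:R * v i l 0 - (Num.floor (N%:R * v i l 0))%:~R).
have er1 (i l : 'I_g) : `|er i l 0| <= 1.
  rewrite mxE ler_norml; have := Num.Theory.floor_itv (N%:R * v i l 0).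
  by rewrite intrD => /andP[? ?]; apply/andP; split; lra.
have uE i : u i = N%:R *: delta_mx i 0 + - N%:R *: v i + er i.
  apply/matrixP => l z; rewrite ord1 !mxE rmorphB /=; case: eqP => _ /=.
    by rewrite -pmulrn; ring.
  by ring.
have uB (i l : 'I_g) : `|u i l 0| <= N%:R * (B + 2).
  have a1 := er1 i l; have a2 := vB i l.
  have h1 : `|N%:R * (delta_mx i 0 : 'cV[R]_g) l 0| <= N%:R.
    rewrite normrM normr_nat ler_piMr// mxE.
    by case: (_ && _); rewrite ?normr0 ?normr1.
  have h2 : `|N%:R * v i l 0| <= N%:R * B by rewrite normrM normr_nat ler_wpM2l.
  have -> : u i l 0 = N%:R * (delta_mx i 0 : 'cV[R]_g) l 0 - N%:R * v i l 0 + er i l 0.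
    by rewrite uE mxE [X in X + _]mxE [X in X + _ + _]mxE [X in _ + X + _]mxE mulNr.
  move: a1 h1 h2; rewrite !ler_norml => /andP[? ?] /andP[? ?] /andP[? ?].
  by apply/andP; split; lra.
have us (i l : 'I_g) : (i < l)%N -> u i l 0 = 0 by move=> il; rewrite mxE mxE W0.
(* The contributions of [N e_i] and [N v_i] cancel and only the rounding error is left, so this
   bound does not depend on [N]. Pairing with [u j], whose entries are of order [N], therefore gives
   order [N] and not [N^2]. *)
have E1 (i j : 'I_g) : (j < i)%N -> `|bform beta (u i) (delta_mx j 0)| <= g%:R * beta j j.
  move=> ji; rewrite uE !bformDl !bformZl bform_delta2 vb// mulNr subrr add0r.
  rewrite bform_delta (le_trans (ler_norm_sum _ _ _))//.
  apply: (@le_trans _ _ (\sum_(l < g) beta j j)).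
    apply: ler_sum => l _; rewrite normrM -[leRHS]mul1r ler_pM//.
    exact: coer_off.
  by rewrite sumr_const card_ord mulr_natl.
split=> // [l i|i j ji]; first by have := uB i l; rewrite mxE mxE.
rewrite -/(u i) -/(u j) bform_sumr (le_trans (ler_norm_sum _ _ _))//.
apply: (@le_trans _ _ (\sum_(l < g) N%:R * (B + 2) * (g%:R * beta j j))).
  apply: ler_sum => l _; rewrite normrM.
  have [lj|jl] := leqP l j; last first.
    rewrite us// normr0 mul0r !mulr_ge0 ?addr_ge0//.
    by rewrite ltW// coer_gt0.
  apply: ler_pM => //; apply: le_trans (E1 i l (leq_ltn_trans lj ji)) _.
  by rewrite ler_wpM2l// coer_mono.
rewrite sumr_const card_ord -[leLHS]mulr_natl natrM.
by rewrite le_eqVlt; apply/orP; left; apply/eqP; ring.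
Qed.

End ReducedBasis.

(** * Linear forms *)

Section LinearForms.
Variables (R : realType) (g : nat) (W : 'M[int]_g) (alpha : R) (T : nat).
Implicit Types (beta : 'M[R]_g) (y : 'cV[R]_g) (kappa : 'cV[int]_g).

Definition intrmx m n (A : 'M[int]_(m, n)) : 'M[R]_(m, n) := map_mx intr A.

Definition rdet : R := (\det W)%:~R.

Definition tilted beta : 'M[R]_g := (intrmx W)^T *m beta *m intrmx W.

(** The factor [rdet] makes the linear part scale like the quadratic one: pairing with [adj W k]
    gives [rdet^2] times the product of [k] and [y]. *)
Definition tilted_vec y : 'cV[R]_g := rdet *: ((intrmx W)^T *m y).

(** On the cone the diagonal is nondecreasing, so this picks the smaller diagonal entry while
    keeping the forms linear in [beta]. *)
Definition ord_min (i j : 'I_g) : 'I_g := if (i <= j)%N then i else j.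

Definition sgb (K : pzRingType) (s : bool) : K := if s then 1 else -1.

Definition form_index : finType := ('I_g + 'I_g * 'I_g * bool + 'I_g * bool)%type.

(* The forms come from
     2 x_i x_j b = ((x_i + x_j)^2 (A + b) + (x_i - x_j)^2 (A - b)) / 2
                   - A (x_i^2 + x_j^2)
   applied to the entries [b] of [tilted beta], where [A = alpha beta_min], and
   to the entries of [tilted_vec y / T], where [x_j] is the constant [T]. *)
Definition lin_form y beta (t : form_index) : R :=
  match t with
  | inl (inl j) => tilted beta j j
      - alpha * \sum_i beta (ord_min i j) (ord_min i j) - alpha * beta j j
  | inl (inr (i, j, s)) => alpha * beta (ord_min i j) (ord_min i j)
      + sgb R s * (if i == j then 0 else tilted beta i j)
  | inr (i, s) => alpha * beta i i + sgb R s * (tilted_vec y i 0 / T%:R)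
  end.

(** Real version of [mult]: the quadratic identity is also evaluated at non-integral vectors, to
    prove positive definiteness. *)
Definition rmult (x : 'I_g -> R) (t : form_index) : R :=
  match t with
  | inl (inl j) => 4 * x j ^+ 2
  | inl (inr (i, j, s)) => (x i + sgb R s * x j) ^+ 2
  | inr (i, s) => 2 * (x i + sgb R s * T%:R) ^+ 2
  end.

Definition mult kappa (t : form_index) : nat :=
  match t with
  | inl (inl j) => 4 * absz (kappa j 0) ^ 2
  | inl (inr (i, j, s)) => absz (kappa i 0 + sgb int s * kappa j 0)%R ^ 2
  | inr (i, s) => 2 * absz (kappa i 0 + sgb int s * T)%R ^ 2
  end.

Lemma natr_abszX2 (m : int) : (absz m ^ 2)%:R = m%:~R ^+ 2 :> R.
Proof. by rewrite natrX natr_absz intr_norm real_normK ?num_real. Qed.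

Lemma mult_rmult kappa t : (mult kappa t)%:R = rmult (fun i => (kappa i 0)%:~R) t.
Proof.
have sg (s : bool) : (sgb int s)%:~R = sgb R s by case: s.
case: t => [[j|[[i j] s]]|[i s]] /=.
- by rewrite natrM natr_abszX2.
- by rewrite natr_abszX2 intrD intrM sg.
- by rewrite natrM natr_abszX2 intrD intrM sg.
Qed.

Lemma ord_minC i j : ord_min i j = ord_min j i.
Proof. by rewrite /ord_min; case: (ltngtP i j) => // /val_inj. Qed.

Lemma sum_form_index (F : form_index -> R) :
  \sum_t F t = \sum_j F (inl (inl j)) +
    \sum_i \sum_j (F (inl (inr (i, j, true))) + F (inl (inr (i, j, false)))) +
    \sum_i (F (inr (i, true)) + F (inr (i, false))).
Proof.
rewrite big_sumType big_sumType /=; congr (_ + _ + _).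
  rewrite (eq_bigr (fun x => F (inl (inr (x.1, x.2))))); last by case.
  rewrite -(pair_bigA _ (fun a b => F (inl (inr (a, b))))) /=.
  rewrite (eq_bigr (fun x => (fun i j => F (inl (inr (i, j, true))) +
     F (inl (inr (i, j, false)))) x.1 x.2)); last first.
    by case=> i j _; rewrite big_bool.
  by rewrite -(pair_bigA _ (fun i j => F (inl (inr (i, j, true))) +
     F (inl (inr (i, j, false))))).
rewrite (eq_bigr (fun x => F (inr (x.1, x.2)))); last by case.
rewrite -(pair_bigA _ (fun a b => F (inr (a, b)))) /=.
by apply: eq_bigr => i _; rewrite big_bool.
Qed.

Lemma offdiag_identity y beta (x : 'I_g -> R) :
  4 * qform (tilted beta) (\col_i x i) =
  \sum_j rmult x (inl (inl j)) * (lin_form y beta (inl (inl j)) + alpha * beta j j) +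
  \sum_i \sum_j (rmult x (inl (inr (i, j, true))) * lin_form y beta (inl (inr (i, j, true)))
    + rmult x (inl (inr (i, j, false))) * lin_form y beta (inl (inr (i, j, false)))).
Proof.
rewrite /=; set bp := tilted beta; pose bm i j := beta (ord_min i j) (ord_min i j).
have step i j : (x i + sgb R true * x j) ^+ 2 *
    (alpha * beta (ord_min i j) (ord_min i j) + sgb R true * (if i == j then 0 else bp i j)) +
  (x i + sgb R false * x j) ^+ 2 *
    (alpha * beta (ord_min i j) (ord_min i j) + sgb R false * (if i == j then 0 else bp i j)) =
  2 * alpha * (x i ^+ 2 * bm i j) + 2 * alpha * (x j ^+ 2 * bm i j) +
  4 * (x i * (if i == j then 0 else bp i j) * x j).
  by rewrite /sgb /bm; ring.
rewrite (eq_bigr _ (fun i _ => eq_bigr _ (fun j _ => step i j))).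
rewrite (eq_bigr (fun i => 2 * alpha * \sum_j (x i ^+ 2 * bm i j) +
   2 * alpha * \sum_j (x j ^+ 2 * bm i j) +
   4 * \sum_j (x i * (if i == j then 0 else bp i j) * x j))); last first.
  by move=> i _; rewrite !big_split/= !mulr_sumr.
rewrite !big_split/= -!mulr_sumr.
have -> : \sum_i \sum_j x j ^+ 2 * bm i j = \sum_i x i ^+ 2 * \sum_j bm i j.
  rewrite exchange_big; apply: eq_bigr => i _; rewrite mulr_sumr.
  by apply: eq_bigr => j _; rewrite /bm ord_minC.
have -> : \sum_i \sum_j x i ^+ 2 * bm i j = \sum_i x i ^+ 2 * \sum_j bm i j.
  by apply: eq_bigr => i _; rewrite mulr_sumr.
have -> : \sum_j 4 * x j ^+ 2 *
    (bp j j - alpha * \sum_i beta (ord_min i j) (ord_min i j) - alpha * beta j j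
     + alpha * beta j j) =
  4 * \sum_j x j * bp j j * x j - 4 * alpha * \sum_j x j ^+ 2 * \sum_i bm j i.
  rewrite !mulr_sumr -sumrB; apply: eq_bigr => j _.
  have -> : \sum_i beta (ord_min i j) (ord_min i j) = \sum_i bm j i.
    by apply: eq_bigr => i _; rewrite /bm ord_minC.
  by move: (\sum_i bm j i) => S; ring.
have -> : qform bp (\col_i x i) = \sum_j x j * bp j j * x j +
    \sum_i \sum_j x i * (if i == j then 0 else bp i j) * x j.
  rewrite qform_bform bformE -big_split/=; apply: eq_bigr => i _.
  rewrite (bigD1 i)//= [in RHS](bigD1 i)//= eqxx mulr0 mul0r add0r !mxE.
  congr (_ + _); apply: eq_bigr => j ji; rewrite !mxE eq_sym (negbTE ji)//.
by ring.
Qed.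

(** The squares [x_i^2] left over by this polarisation are exactly those paid for by the term
    [- alpha * beta j j] in the diagonal forms; the squares of the constant [T] give the part
    independent of [x]. *)
Lemma vec_identity y beta (x : 'I_g -> R) : (0 < T)%N ->
  \sum_i (rmult x (inr (i, true)) * lin_form y beta (inr (i, true))
    + rmult x (inr (i, false)) * lin_form y beta (inr (i, false))) =
  \sum_j rmult x (inl (inl j)) * (alpha * beta j j) +
  8 * \sum_i x i * tilted_vec y i 0 + 4 * alpha * T%:R ^+ 2 * \sum_i beta i i.
Proof.
move=> T0; rewrite !mulr_sumr -!big_split/=; apply: eq_bigr => i _.
by rewrite /sgb /=; field; rewrite pnatr_eq0 -lt0n.
Qed.

(** With [kappa = adj W k] one has [W kappa = (det W) k], so [qform (tilted beta) kappa] is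
    [rdet^2 qform beta k]. The additional summand does not depend on [k] and comes out of the theta
    series as a common factor. *)
Lemma forms_identity y beta (k : 'cV[int]_g) : (0 < T)%N ->
  4 * rdet ^+ 2 * (qform beta (intrmx k) + 2 * dot (intrmx k) y) +
    4 * alpha * T%:R ^+ 2 * \sum_i beta i i =
  \sum_t (mult (\adj W *m k) t)%:R * lin_form y beta t.
Proof.
move=> T0; set kappa := \adj W *m k.
pose x i : R := (kappa i 0)%:~R.
have xE : \col_i x i = intrmx kappa by apply/matrixP => i j; rewrite ord1 [LHS]mxE [RHS]mxE.
have Wk : intrmx W *m intrmx kappa = rdet *: intrmx k.
  rewrite /intrmx -map_mxM mulmxA mul_mx_adj mul_scalar_mx.
  by rewrite map_mxZ.
have q : rdet ^+ 2 * qform beta (intrmx k) = qform (tilted beta) (\col_i x i).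
  rewrite xE -qformZx -Wk /qform /tilted trmx_mul !mulmxA//.
have v : \sum_i x i * tilted_vec y i 0 = rdet ^+ 2 * dot (intrmx k) y.
  have -> : \sum_i x i * tilted_vec y i 0 = dot (\col_i x i) (tilted_vec y).
    by rewrite /dot mxE; apply: eq_bigr => i _; rewrite !mxE.
  rewrite xE /dot /tilted_vec -scalemxAr mulmxA -trmx_mul Wk linearZ/= -scalemxAl.
  by rewrite scalerA mxE expr2.
rewrite (eq_bigr (fun t => rmult x t * lin_form y beta t)); last first.
  by move=> t _; rewrite mult_rmult.
rewrite sum_form_index vec_identity// v.
have := offdiag_identity y beta x; rewrite -q.
rewrite (eq_bigr (fun j => rmult x (inl (inl j)) * lin_form y beta (inl (inl j)) +
  rmult x (inl (inl j)) * (alpha * beta j j))); last by move=> j _; rewrite mulrDr.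
rewrite big_split/=.
set S1 := \sum_(i < g) \sum_(j < g) _; set S3 := \sum_(j < g) _ * (alpha * _).
set S2 := \sum_(j < g) _ => H.
have -> : S2 + S1 = 4 * (rdet ^+ 2 * qform beta (intrmx k)) - S3 by rewrite H; ring.
by ring.
Qed.

End LinearForms.

(** * Finitely many matrices suffice on the cone *)

Section Cover.
Variable R : realType.

Lemma tiltedE (g : nat) (W : 'M[int]_g) (beta : 'M[R]_g) i j :
  tilted W beta i j = bform beta (col i (map_mx intr W)) (col j (map_mx intr W)).
Proof.
rewrite /tilted /bform tr_col -row_mul -row_mul !mxE.
apply: eq_bigr => l _; rewrite !mxE; congr (_ * _).
Qed.

Lemma cone_covered (g : nat) (m d : R) : (0 < g)%N -> 0 < m -> 0 < d ->
  exists (K : nat) (alpha : R) (T : nat), (0 < T)%N /\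
  forall beta : 'M[R]_g, minkowski_cone beta ->
  (forall k : 'I_g, k = 0%N :> nat -> d <= beta k k) ->
  forall y : 'cV[R]_g, (forall i, `|y i 0| <= m * beta i i) ->
  exists W : 'M[int]_g, [/\ \det W != 0, forall i j, (absz (W i j) <= K)%N &
    forall t, d <= lin_form W alpha T y beta t].
Proof.
move=> g0 m0 d0.
have [c c0 cP] := minkowski_coercive R g.
have [B B0 BP] := @reduced_basis R g c c0.
pose G : R := (g * g)%:R.
have G1 : 1 <= G by rewrite /G ler1n muln_gt0 g0.
have gR : 0 <= g%:R :> R by rewrite ler0n.
pose A := G * (B + 2).
have A2 : 2 <= A by rewrite /A; nra.
(* As [N >= 1], this gives [c N^2 >= (g + 1)(A N + 1) + 1]: a diagonal form, from which at most
   [alpha (g + 1) beta j j] is subtracted, keeps at least [beta j j]. *)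
have [N N0 NP] : exists2 N : nat, (0 < N)%N & (g%:R + 1) * (A + 1) + 1 <= c * N%:R.
  pose q := ((g%:R + 1) * (A + 1) + 1) / c.
  have q0 : 0 <= q.
    by rewrite divr_ge0 ?(ltW c0)// addr_ge0// mulr_ge0// addr_ge0//; lra.
  exists (Num.bound q).+1 => //; rewrite [c * _]mulrC -ler_pdivrMr// -/q.
  by rewrite ltW// (lt_le_trans (archi_boundP q0))// ler_nat.
have N1 : 1 <= N%:R :> R by rewrite ler1n.
(* [A N] bounds the off-diagonal entries relative to the smaller diagonal entry; the added 1 leaves
   a margin of one diagonal entry, hence of [d]. *)
pose alpha := A * N%:R + 1.
(* Bound for [tilted_vec W y i 0] relative to [beta i i]: the determinant is [N^g], and by
   triangularity only the entries [y_l] with [l <= i] occur, each at most [m * beta i i]. *)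
pose Y : R := (N ^ g)%:R * (g%:R * (N%:R * (B + 2) * m)).
have Y0 : 0 <= Y by rewrite /Y; do 2!apply: mulr_ge0 => //; rewrite !mulr_ge0// ?addr_ge0// ltW.
pose T := (Num.bound Y).+1.
have TY : Y <= T%:R by rewrite ltW// (lt_le_trans (archi_boundP Y0))// ler_nat.
have T0 : 0 < T%:R :> R by rewrite ltr0n.
exists (Num.bound (N%:R * (B + 2))), alpha, T; split=> //.
move=> beta cb b0d y ym.
have b0 (k : 'I_g) : k = 0%N :> nat -> 0 < beta k k by move=> /b0d; exact: lt_le_trans.
have bg := cone_diag_gt0 cb b0.
have bd i : d <= beta i i.
  by apply: le_trans (b0d (Ordinal g0) erefl) (cone_diag_le cb _).
have sb : beta^T = beta by case: cb.
have cob : coercive c beta.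
  split=> //; [exact: cone_diag_le|exact: cone_offdiagr|exact: cP].
have [W [Wt Wd WB Wo]] := BP N N0 beta cob.
have NB0 : 0 <= N%:R * (B + 2) by rewrite mulr_ge0// addr_ge0.
have dW : \det W = (N ^ g)%N.
  rewrite -det_tr det_trig; last first.
    by apply/is_trig_mxP => i j ij; rewrite mxE Wt.
  rewrite (eq_bigr (fun=> N%:Z)); last by move=> i _; rewrite mxE Wd.
  by rewrite prodr_const card_ord -[N%:Z]natz -natrX natz.
exists W; split.
- by rewrite dW eqz_nat -lt0n expn_gt0 N0.
- move=> i j; rewrite -(ler_nat R) natr_absz intr_norm (le_trans (WB i j))//.
  by rewrite ltW// archi_boundP.
have off (i j : 'I_g) : i != j ->
    `|tilted W beta i j| <= A * N%:R * beta (ord_min i j) (ord_min i j).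
  have key (k l : 'I_g) : (l < k)%N -> `|tilted W beta k l| <= A * N%:R * beta l l.
    move=> lk; rewrite tiltedE (le_trans (Wo k l lk))// /A -/G.
    by rewrite le_eqVlt; apply/orP; left; apply/eqP; ring.
  rewrite /ord_min; case: (ltngtP i j) => [ij|ji|/val_inj ->]; last by rewrite eqxx.
    by move=> _; rewrite tiltedE bformC// -tiltedE key.
  by move=> _; exact: key.
have aN : 0 <= A * N%:R by rewrite mulr_ge0//; lra.
have min_le (i j : 'I_g) : beta (ord_min i j) (ord_min i j) <= beta j j.
  by apply: cone_diag_le => //; rewrite /ord_min; case: (leqP i j).
case=> [[j|[[i j] s]]|[i s]] /=.
- have h1 : c * N%:R ^+ 2 * beta j j <= tilted W beta j j.
    rewrite tiltedE mulrAC; have := cP beta cb b0 (col j (map_mx intr W)) j.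
    by rewrite mxE mxE Wd -pmulrn.
  have h2 : \sum_i beta (ord_min i j) (ord_min i j) <= g%:R * beta j j.
    apply: (@le_trans _ _ (\sum_(i < g) beta j j)); first exact: ler_sum.
    by rewrite sumr_const card_ord mulr_natl.
  have h3 : alpha * \sum_i beta (ord_min i j) (ord_min i j) <= alpha * (g%:R * beta j j).
    by rewrite ler_wpM2l// /alpha addr_ge0.
  have h4 : 1 <= c * N%:R ^+ 2 - alpha * g%:R - alpha.
    have k1 : ((g%:R + 1) * (A + 1) + 1) * N%:R <= c * N%:R ^+ 2.
      by rewrite expr2 mulrA ler_wpM2r// ler0n.
    have H (cn n gg A' : R) : 1 <= n -> 0 <= gg ->
        ((gg + 1) * (A' + 1) + 1) * n <= cn -> 1 <= cn - (A' * n + 1) * gg - (A' * n + 1).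
      move=> n1 gg0 k.
      have p : 0 <= (gg + 2) * (n - 1) by rewrite mulr_ge0 ?subr_ge0 ?addr_ge0.
      rewrite -subr_ge0; have -> : cn - (A' * n + 1) * gg - (A' * n + 1) - 1 =
        (cn - ((gg + 1) * (A' + 1) + 1) * n) + (gg + 2) * (n - 1) by ring.
      by rewrite addr_ge0// subr_ge0.
    exact: H.
  apply: le_trans (bd j) _.
  have : 1 * beta j j <= (c * N%:R ^+ 2 - alpha * g%:R - alpha) * beta j j.
    by rewrite ler_pM2r.
  by lra.
- apply: le_trans (bd (ord_min i j)) _.
  set bm := beta _ _.
  have bm0 : 0 < bm by exact: bg.
  have [ij|ij] := eqVneq i j.
    rewrite mulr0 addr0 /alpha mulrDl mul1r lerDr mulr_ge0// ltW//.
  have := off i j ij; rewrite -/bm ler_norml => /andP[? ?].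
  by rewrite /alpha; case: s; rewrite /sgb; lra.
- have h : `|tilted_vec W y i 0 / T%:R| <= beta i i.
    rewrite normrM [X in _ * X]gtr0_norm ?invr_gt0// ler_pdivrMr//.
    apply: (@le_trans _ _ (Y * beta i i)); last by rewrite mulrC ler_pM2l.
    rewrite /tilted_vec mxE normrM /rdet dW -pmulrn normr_nat /Y -mulrA ler_wpM2l//.
    rewrite mxE (le_trans (ler_norm_sum _ _ _))//.
    apply: (@le_trans _ _ (\sum_(l < g) N%:R * (B + 2) * m * beta i i)); last first.
      by rewrite sumr_const card_ord -[leLHS]mulr_natl mulrA.
    apply: ler_sum => l _; rewrite mxE mxE normrM -mulrA.
    have [li|il] := leqP l i; last first.
      by rewrite Wt// normr0 mul0r mulr_ge0// mulr_ge0// ltW.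
    apply: ler_pM => //; apply: le_trans (ym l) _.
    by rewrite ler_pM2l// cone_diag_le.
  apply: le_trans (bd i) _; move: h; rewrite ler_norml => /andP[? ?].
  have b2 : beta i i <= A * N%:R * beta i i.
    by rewrite ler_peMl ?(ltW (bg i))//; nra.
  by rewrite /alpha; case: s; rewrite /sgb; lra.
Qed.

End Cover.

(** * Sums over lattices *)

Section LatticeSums.
Variable R : realType.

Lemma abs_bounded_inj (I J : choiceType) (phi : I -> J) (f : J -> R) (M : R) :
  injective phi -> abs_bounded f M -> abs_bounded (fun i => f (phi i)) M.
Proof.
move=> inj fM A; have := fM [fset phi i | i in A]%fset.
by rewrite big_imfset//= => ? ? _ _; exact: inj.
Qed.

Lemma abs_bounded_geometric (q : R) : 0 <= q -> q < 1 ->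
  abs_bounded (fun k : nat => q ^+ k) (1 - q)^-1.
Proof.
move=> q0 q1; apply: abs_bounded_series => n.
rewrite (eq_bigr (fun k => q ^+ k)); last by move=> k _; rewrite ger0_norm// exprn_ge0.
have d0 : 0 < 1 - q by rewrite subr_gt0.
rewrite -[leRHS]mul1r ler_pdivlMr//.
suff -> : (\sum_(0 <= i < n) q ^+ i) * (1 - q) = 1 - q ^+ n.
  by rewrite gerBl exprn_ge0.
elim: n => [|n IH]; first by rewrite big_nil mul0r expr0 subrr.
by rewrite big_nat_recr//= mulrDl IH exprS; ring.
Qed.

Lemma abs_bounded_geometric_int (q : R) : 0 <= q -> q < 1 ->
  abs_bounded (fun m : int => q ^+ absz m) ((1 - q)^-1 * 2).
Proof.
move=> q0 q1.
have H : abs_bounded (fun x : bool * nat => q ^+ x.2) ((1 - q)^-1 * 2).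
  apply: (@abs_bounded_pair _ _ _ _ (fun=> (1 - q)^-1)).
    by move=> b; exact: abs_bounded_geometric.
  move=> A; have q'0 : 0 <= (1 - q)^-1 by rewrite invr_ge0 subr_ge0 ltW.
  rewrite ger0_norm// big_const_seq count_predT iter_addr_0.
  rewrite -[leLHS]mulr_natr ler_wpM2l// ler_nat.
  by rewrite -card_bool cardT; apply: uniq_leq_size => // b _; rewrite mem_enum.
have inj : injective (fun m : int => (m < 0, absz m)).
  by move=> m m' [E1 E2]; lia.
exact: (abs_bounded_inj inj H).
Qed.

Lemma abs_bounded_lattice (g : nat) (q : R) : 0 <= q -> q < 1 ->
  exists M : R, abs_bounded (fun k : 'cV[int]_g => \prod_i q ^+ absz (k i 0)) M.
Proof.
move=> q0 q1; elim: g => [|g [M HM]].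
  exists `|1|; have inj : injective (fun k : 'cV[int]_0 => tt).
    by move=> k k' _; apply/matrixP => -[].
  apply: (le_abs_bounded (abs_bounded_inj inj (@abs_bounded_unit R (fun=> 1)))) => // k.
  by rewrite big_ord0.
exists ((1 - q)^-1 * 2 * M).
have M0 : 0 <= M by have := HM fset0; rewrite big_seq_fset0.
have H : abs_bounded (fun x : int * 'cV[int]_g =>
    q ^+ absz x.1 * \prod_i q ^+ absz (x.2 i 0)) ((1 - q)^-1 * 2 * M).
  apply: (@abs_bounded_pair _ _ _ _ (fun m : int => q ^+ absz m * M)).
    move=> m A /=; rewrite (eq_bigr (fun j : 'cV[int]_g => q ^+ absz m * `|\prod_i q ^+ absz (j i 0)|)); last first.
      by move=> j _; rewrite normrM ger0_norm// exprn_ge0.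
    by rewrite -big_distrr/= ler_wpM2l ?exprn_ge0.
  move=> A; rewrite (eq_bigr (fun m : int => `|q ^+ absz m| * M)); last first.
    by move=> m _; rewrite normrM (ger0_norm M0).
  by rewrite -big_distrl/= ler_wpM2r//; exact: abs_bounded_geometric_int.
pose phi (k : 'cV[int]_g.+1) : int * 'cV[int]_g := (k 0 0, \col_i k (lift 0 i) 0).
have inj : injective phi.
  move=> k k' [E0 /matrixP E]; apply/matrixP => i j; rewrite !ord1.
  case: (unliftP 0 i) => [l ->|->//].
  by have := E l 0; rewrite !mxE.
apply: (le_abs_bounded (abs_bounded_inj inj H)) => // k.
rewrite big_ord_recl /phi /= (eq_bigr (fun i : 'I_g => q ^+ absz ((\col_i k (lift 0 i) 0) i 0)))//.
by move=> i _; rewrite mxE.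
Qed.

Lemma restricted_analytic_trig_series_fin (V : finType) (I : choiceType)
    (c : I -> R) (e : I -> V -> nat) (L : I -> V -> R) (phi r M : R) : 0 < r ->
  abs_bounded (fun i => c i * \prod_v (1 + r) ^+ e i v *
                        expR (\sum_v `|L i v| * r)) M ->
  exists2 f : 'cV[R]_#|V| -> R, restricted_analytic f &
    forall x : V -> R, (forall v, `|x v| <= 1) ->
      is_sum (fun i => c i * \prod_v x v ^+ e i v * cos (\sum_v L i v * x v + phi))
             (f (\col_j x (enum_val j))).
Proof.
move=> r0 cM.
have sE (F : V -> R) : \sum_v F v = \sum_(j < #|V|) F (enum_val j).
  by rewrite (reindex _ (onW_bij _ (@enum_val_bij V))).
have pE (F : V -> R) : \prod_v F v = \prod_(j < #|V|) F (enum_val j).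
  by rewrite (reindex _ (onW_bij _ (@enum_val_bij V))).
have [|f rf fP] := @restricted_analytic_trig_series R #|V| I c
    (fun i j => e i (enum_val j)) (fun i j => L i (enum_val j)) phi r M r0.
  by apply: (le_abs_bounded cM) => // i; rewrite pE sE.
exists f => // x x1.
have xb : unit_box (\col_(j < #|V|) x (enum_val j)) by move=> j; rewrite mxE.
apply: (eq_is_sum (fP _ xb)) => i; rewrite /trig_term pE sE; congr (_ * _ * cos (_ + _)).
  by apply: eq_bigr => j _; rewrite mxE.
by apply: eq_bigr => j _; rewrite mxE.
Qed.

End LatticeSums.

(** * Theta series as restricted analytic functions *)

Section ThetaPiece.
Variables (R : realType) (g : nat) (W : 'M[int]_g) (alpha : R) (T : nat) (eps Rb : R).
Hypotheses (detW : \det W != 0) (T0 : (0 < T)%N) (eps0 : 0 < eps) (Rb0 : 0 < Rb).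
Local Notation piR := (pi : R).

Definition piece_index : finType := (form_index g + 'I_g * 'I_g + 'I_g)%type.

(** Chosen so that its product with the factor [4 * rdet^2] of [forms_identity] is pi. *)
Definition piece_rate : R := piR / (4 * rdet R W ^+ 2).

(** Lies in the unit box as soon as the forms are at least [eps] and the real parts at most [Rb].
    Subtracting [eps] moves a factor [expR (- (piece_rate * eps))] per unit of multiplicity into the
    coefficients; this factor makes the series converge beyond the box. *)
Definition piece_coord (xz : 'cV[R]_g) (xt : 'M[R]_g) (y : 'cV[R]_g) (beta : 'M[R]_g)
    (v : piece_index) : R :=
  match v with
  | inl (inl t) => expR (- (piece_rate * (lin_form W alpha T y beta t - eps)))
  | inl (inr (i, j)) => Rb^-1 * xt i j
  | inr i => Rb^-1 * xz i 0
  end.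

Definition piece_exp (k : 'cV[int]_g) (v : piece_index) : nat :=
  if v is inl (inl t) then mult T (\adj W *m k) t else 0%N.

Definition piece_freq (k : 'cV[int]_g) (v : piece_index) : R :=
  match v with
  | inl (inl t) => 0
  | inl (inr (i, j)) => piR * Rb * ((k i 0)%:~R * (k j 0)%:~R)
  | inr i => piR * Rb * (2 * (k i 0)%:~R)
  end.

Lemma rdet_ge1 : 1 <= rdet R W ^+ 2.
Proof.
rewrite /rdet -rmorphXn/= ler1z -gtz0_ge1 exprn_even_gt0//.
Qed.

Lemma piece_rate_gt0 : 0 < piece_rate.
Proof. by rewrite divr_gt0 ?pi_gt0// mulr_gt0// (lt_le_trans ltr01 rdet_ge1). Qed.

Lemma sum_sq_le (a : 'I_g -> R) :
  \sum_i \sum_j `|a i| * `|a j| <= g%:R * \sum_i a i ^+ 2.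
Proof.
have -> : g%:R * \sum_i a i ^+ 2 = \sum_i \sum_j 2^-1 * (a i ^+ 2 + a j ^+ 2).
  rewrite [RHS](eq_bigr (fun i => 2^-1 * (g%:R * a i ^+ 2) + 2^-1 * \sum_j a j ^+ 2)); last first.
    move=> i _; rewrite -mulr_sumr big_split/= sumr_const card_ord mulrDr.
    by rewrite -[X in 2^-1 * X]mulr_natl.
  rewrite big_split/= -!mulr_sumr sumr_const card_ord.
  by rewrite -[(\sum_(j < g) _) *+ g]mulr_natl; lra.
apply: ler_sum => i _; apply: ler_sum => j _.
rewrite -(real_normK (num_real (a i))) -(real_normK (num_real (a j))).
have := sqr_ge0 (`|a i| - `|a j|); nra.
Qed.

(** Compares the frequencies, quadratic in [k], with the multiplicities, quadratic in [adj W k]: the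
    entries of [k] are recovered from [(det W) k = W (adj W k)] with [|det W| >= 1]. *)
Lemma lattice_coord_le : exists2 H : R, 0 <= H & forall k : 'cV[int]_g,
  \sum_i \sum_j `|(k i 0)%:~R| * `|(k j 0)%:~R| + 2 * \sum_i `|(k i 0)%:~R| <=
    H * \sum_i ((\adj W *m k) i 0)%:~R ^+ 2 :> R.
Proof.
pose om : R := \sum_i \sum_j `|(W i j)%:~R|.
have omW i j : `|(W i j)%:~R| <= om.
  have h0 l : 0 <= \sum_j `|(W l j)%:~R : R| by exact: sumr_ge0.
  apply: (@le_trans _ _ (\sum_j `|(W i j)%:~R : R|)).
    by rewrite (bigD1 j)//= lerDl sumr_ge0.
  by rewrite /om [leRHS](bigD1 i)//= lerDl sumr_ge0.
exists ((g%:R + 2) * (g%:R * (om ^+ 2 * g%:R))).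
  by apply: mulr_ge0; rewrite ?addr_ge0// mulr_ge0// mulr_ge0// sqr_ge0.
move=> k; set kappa := \adj W *m k; set sg := \sum_i _ ^+ 2.
pose a i : R := (k i 0)%:~R.
apply: (@le_trans _ _ ((g%:R + 2) * \sum_i a i ^+ 2)).
  rewrite [leRHS]mulrDl lerD//; first exact: sum_sq_le.
  rewrite ler_pM2l//; apply: ler_sum => i _.
  rewrite -intr_norm -rmorphXn/= ler_int expr2; move: (k i 0) => z; nia.
rewrite -mulrA ler_wpM2l ?addr_ge0//.
apply: (@le_trans _ _ (\sum_(i < g) om ^+ 2 * g%:R * sg)); last first.
  by rewrite sumr_const card_ord -[leLHS]mulr_natl mulrA.
apply: ler_sum => i _.
have E : (\det W)%:~R * a i = \sum_j (W i j)%:~R * (kappa j 0)%:~R.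
  have : (W *m kappa) i 0 = \det W * k i 0.
    by rewrite /kappa mulmxA mul_mx_adj mul_scalar_mx mxE.
  rewrite mxE => /(congr1 (fun m : int => m%:~R : R)).
  rewrite rmorphM rmorph_sum /= => <-; apply: eq_bigr => j _.
  by rewrite rmorphM.
have h1 : a i ^+ 2 <= (\sum_j (W i j)%:~R * (kappa j 0)%:~R) ^+ 2.
  by rewrite -E exprMn ler_peMl ?sqr_ge0// rdet_ge1.
apply: le_trans h1 _.
have h2 : `|\sum_j (W i j)%:~R * (kappa j 0)%:~R| <= om * \sum_j `|(kappa j 0)%:~R|.
  rewrite (le_trans (ler_norm_sum _ _ _))// mulr_sumr; apply: ler_sum => j _.
  by rewrite normrM ler_wpM2r.
rewrite -(real_normK (num_real (\sum_j _))).
apply: (@le_trans _ _ ((om * \sum_j `|(kappa j 0)%:~R|) ^+ 2)).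
  by rewrite lerXn2r ?nnegrE// (le_trans _ h2).
rewrite exprMn -mulrA ler_wpM2l ?sqr_ge0//.
apply: le_trans (sum_sq_le (fun j => (kappa j 0)%:~R)).
rewrite expr2 mulr_suml; apply: ler_sum => l _.
by rewrite mulr_sumr.
Qed.

Lemma adj_inj : injective (fun k : 'cV[int]_g => \adj W *m k).
Proof.
move=> k k' /(congr1 (mulmx W)); rewrite !mulmxA mul_mx_adj !mul_scalar_mx.
move=> /matrixP E; apply/matrixP => i j; have := E i j; rewrite !mxE.
exact: mulfI.
Qed.

Lemma piece_bound : exists r M : R, 0 < r /\
  abs_bounded (fun k : 'cV[int]_g =>
    expR (- (piece_rate * eps)) ^+ (\sum_t mult T (\adj W *m k) t)%N *
    \prod_v (1 + r) ^+ piece_exp k v * expR (\sum_v `|piece_freq k v| * r)) M.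
Proof.
have [H H0 HP] := lattice_coord_le.
have : 0 < piece_rate * eps by rewrite mulr_gt0// piece_rate_gt0.
move: (piece_rate * eps) => dl dl0.
have pr0 : 0 <= piR * Rb * H by rewrite !mulr_ge0// ?pi_ge0 ?ltW.
(* A unit of multiplicity contributes at most [expR (r - dl)], and [r <= dl] allows the exponent [S]
   to be lowered to the sum [sg] of the squares of [kappa]. The frequencies cost at most
   [expR (pi Rb H r sg)], so this [r] leaves [expR (- (dl / 2) sg)]. *)
have [r [r0 rE rdl]] : exists r, [/\ 0 < r, r * (1 + piR * Rb * H) = dl / 2 & r <= dl].
  move: (piR * Rb * H) pr0 => z z0; have d0 : 0 < 2 * (1 + z) by lra.
  exists (dl / (2 * (1 + z))); split; first exact: divr_gt0.
    by field; rewrite gt_eqF//; lra.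
  by rewrite ler_pdivrMr// ler_peMr ?ltW//; lra.
pose q := expR (- (dl / 2)).
have q0 : 0 <= q by rewrite expR_ge0.
have q1 : q < 1 by rewrite -expR0 ltr_expR oppr_lt0 divr_gt0.
have [M HM] := abs_bounded_lattice g q0 q1.
exists r, M; split=> //.
apply: (le_abs_bounded (abs_bounded_inj adj_inj HM)) => // k /=.
set kappa := \adj W *m k; set S := (\sum_t _)%N.
have pE : \prod_v (1 + r) ^+ piece_exp k v = (1 + r) ^+ S.
  rewrite big_sumType big_sumType /= [X in _ * X]big1 ?mulr1//.
  by rewrite [X in _ * X]big1 ?mulr1 -?prodrXr// => -[].
have sE : \sum_v `|piece_freq k v| = piR * Rb *
    (\sum_i \sum_j `|(k i 0)%:~R| * `|(k j 0)%:~R| + 2 * \sum_i `|(k i 0)%:~R|).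
  rewrite big_sumType big_sumType /= [X in X + _ + _]big1 ?add0r; last first.
    by move=> t _; rewrite normr0.
  have pRb : 0 <= piR * Rb by rewrite mulr_ge0 ?pi_ge0// ltW.
  rewrite mulrDr; congr (_ + _).
    rewrite (pair_bigA _ (fun i j => `|(k i 0)%:~R : R| * `|(k j 0)%:~R|)) mulr_sumr/=.
    by apply: eq_bigr => -[i j] _; rewrite !normrM -normrM (ger0_norm pRb).
  rewrite !mulr_sumr; apply: eq_bigr => i _.
  by rewrite normrM (ger0_norm pRb) normrM normr_nat.
rewrite pE -mulr_suml sE -exprMn.
set sg := (\sum_j absz (kappa j 0%R) ^ 2)%N.
have sgE : \sum_i (kappa i 0)%:~R ^+ 2 = sg%:R :> R.
  by rewrite natr_sum; apply: eq_bigr => i _; rewrite natr_abszX2.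
have sgS : (sg <= S)%N.
  rewrite /S big_sumType big_sumType /= -addnA.
  by apply: leq_trans (leq_addr _ _); apply: leq_sum => j _; exact: leq_pmull.
have e1 : expR (- dl) * (1 + r) <= expR (r - dl).
  by rewrite expRD mulrC ler_wpM2r ?expR_ge0// expR_ge1Dx.
have b0 : 0 <= expR (- dl) * (1 + r) by rewrite mulr_ge0 ?expR_ge0// addr_ge0// ltW.
rewrite ger0_norm; last by rewrite mulr_ge0 ?expR_ge0// exprn_ge0.
rewrite ger0_norm; last by apply: prodr_ge0 => i _; rewrite exprn_ge0.
apply: (@le_trans _ _ (expR ((r - dl) * sg%:R) * expR (piR * Rb * (H * sg%:R) * r))).
  apply: ler_pM; rewrite ?expR_ge0 ?exprn_ge0//.
    apply: (@le_trans _ _ (expR (r - dl) ^+ S)); first by rewrite lerXn2r ?nnegrE ?expR_ge0.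
    rewrite -expRM_natr ler_expR.
    by rewrite ler_wnM2l ?subr_le0// ler_nat.
  rewrite ler_expR ler_wpM2r ?(ltW r0)// ler_wpM2l ?mulr_ge0 ?pi_ge0 ?(ltW Rb0)//.
  by rewrite -sgE; exact: HP.
rewrite -expRD.
have -> : (r - dl) * sg%:R + piR * Rb * (H * sg%:R) * r = - (dl / 2) * sg%:R.
  have -> : (r - dl) * sg%:R + piR * Rb * (H * sg%:R) * r =
     (r * (1 + piR * Rb * H) - dl) * sg%:R by ring.
  by rewrite rE; congr (_ * _); field.
(* As [|n| <= n^2] for integers, the Gaussian bound is dominated by a product of geometric series in
   [kappa]. *)
rewrite expRM_natr -/q -prodrXr; apply: ler_prod => j _.
rewrite exprn_ge0//= /q; apply: ler_wiXn2l => //; first exact: ltW.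
by rewrite -mulnn; case: (absz _) => // n; rewrite leq_pmulr.
Qed.

(* [phi = 0] gives the real part of the theta series, [phi = - pi / 2] the
   imaginary part. *)
Lemma theta_piece (phi : R) : exists2 f : 'cV[R]_#|piece_index| -> R,
  restricted_analytic f &
  forall (xz : 'cV[R]_g) (xt : 'M[R]_g) (y : 'cV[R]_g) (beta : 'M[R]_g), (forall t, eps <= lin_form W alpha T y beta t) ->
    (forall i, `|xz i 0| <= Rb) -> (forall i j, `|xt i j| <= Rb) ->
    is_sum (fun k : 'cV[int]_g =>
        expR (- (piR * (qform beta (intrmx R k) + 2 * dot (intrmx R k) y))) *
        cos (piR * (qform xt (intrmx R k) + 2 * dot (intrmx R k) xz) + phi))
      (expR (4 * piece_rate * (alpha * T%:R ^+ 2 * \sum_i beta i i)) *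
       f (\col_j piece_coord xz xt y beta (enum_val j))).
Proof.
have [r [M [r0 rM]]] := piece_bound.
have [f rf fP] := restricted_analytic_trig_series_fin phi r0 rM.
exists f => // xz xt y beta lf xzR xtR.
have x1 v : `|piece_coord xz xt y beta v| <= 1.
  case: v => [[t|[i j]]|i] /=.
  - rewrite ger0_norm ?expR_ge0// -expR0 ler_expR oppr_le0 mulr_ge0//.
      exact/ltW/piece_rate_gt0.
    by rewrite subr_ge0.
  - by rewrite normrM gtr0_norm ?invr_gt0// mulrC ler_pdivrMr// mul1r.
  - by rewrite normrM gtr0_norm ?invr_gt0// mulrC ler_pdivrMr// mul1r.
apply: (eq_is_sum (is_sumZ _ (fP _ x1))) => k.
rewrite mulrA; congr (_ * cos (_ + _)).
  have -> : \prod_v piece_coord xz xt y beta v ^+ piece_exp k v =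
      \prod_t piece_coord xz xt y beta (inl (inl t)) ^+ mult T (\adj W *m k) t.
    rewrite big_sumType big_sumType /= [X in _ * X]big1 ?mulr1//.
    by rewrite [X in _ * X]big1 ?mulr1// => -[].
  rewrite -prodrXr -big_split/=.
  rewrite (eq_bigr (fun t => expR (- piece_rate * ((mult T (\adj W *m k) t)%:R *
     lin_form W alpha T y beta t)))); last first.
    move=> t _; rewrite -exprMn -expRD -expRM_natr; congr expR; ring.
  rewrite -expR_sum -mulr_sumr -forms_identity// -expRD; congr expR.
  rewrite /piece_rate; field.
  by rewrite /rdet intr_eq0.
rewrite big_sumType big_sumType /= big1 ?add0r; last by move=> t _; rewrite mul0r.
rewrite mulrDr; congr (_ + _).
  rewrite qform_bform bformE (pair_bigA _ (fun i j => (intrmx R k) i 0 * xt i j * (intrmx R k) j 0)) mulr_sumr/=.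
  by apply: eq_bigr => -[i j] _ /=; rewrite !mxE; field; rewrite gt_eqF.
rewrite /dot mxE !mulr_sumr; apply: eq_bigr => i _.
by rewrite !mxE; field; rewrite gt_eqF.
Qed.

End ThetaPiece.

(** * Real and imaginary parts *)

Section ComplexParts.
Variable R : realType.
Local Notation Re := (@complex.Re R).
Local Notation Im := (@complex.Im R).

Lemma ReD (x y : R[i]) : Re (x + y) = Re x + Re y. Proof. by case: x y => [? ?] [? ?]. Qed.

Lemma ImD (x y : R[i]) : Im (x + y) = Im x + Im y. Proof. by case: x y => [? ?] [? ?]. Qed.

Lemma ReB (x y : R[i]) : Re (x - y) = Re x - Re y. Proof. by case: x y => [? ?] [? ?]. Qed.

Lemma ImB (x y : R[i]) : Im (x - y) = Im x - Im y. Proof. by case: x y => [? ?] [? ?]. Qed.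

Lemma Re_sum (I : Type) (s : seq I) (F : I -> R[i]) :
  Re (\sum_(i <- s) F i) = \sum_(i <- s) Re (F i).
Proof. exact: (big_morph _ ReD (erefl : Re 0 = 0)). Qed.

Lemma Im_sum (I : Type) (s : seq I) (F : I -> R[i]) :
  Im (\sum_(i <- s) F i) = \sum_(i <- s) Im (F i).
Proof. exact: (big_morph _ ImD (erefl : Im 0 = 0)). Qed.

Lemma ReCM (x : R) (y : R[i]) : Re (x%:C * y) = x * Re y.
Proof. by case: y => [? ?] /=; rewrite mul0r subr0. Qed.

Lemma ImCM (x : R) (y : R[i]) : Im (x%:C * y) = x * Im y.
Proof. by case: y => [? ?] /=; rewrite mul0r addr0. Qed.

Lemma ReMC (x : R) (y : R[i]) : Re (y * x%:C) = Re y * x.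
Proof. by rewrite mulrC ReCM mulrC. Qed.

Lemma ImMC (x : R) (y : R[i]) : Im (y * x%:C) = Im y * x.
Proof. by rewrite mulrC ImCM mulrC. Qed.

Lemma normc_ge_Im (x : R[i]) : `|Im x|%:C <= `|x|.
Proof.
by case: x => a b; rewrite normc_def lecR -sqrtr_sqr ler_wsqrtr//= lerDr sqr_ge0.
Qed.

Lemma normc_le (x : R[i]) : `|x| <= (`|Re x| + `|Im x|)%:C.
Proof.
rewrite normc_def lecR -[leRHS]ger0_norm ?addr_ge0// -sqrtr_sqr ler_wsqrtr//.
rewrite sqrrD !real_normK ?num_real//.
by rewrite -addrA [X in _ <= _ + X]addrC addrA lerDl mulrn_wge0// mulr_ge0.
Qed.

Lemma Re_continuous : continuous (Re : R[i] -> R).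
Proof.
move=> z; have FF : Filter (nbhs z) by exact: nbhs_filter.
apply/(@cvgrPdist_lt _ _ _ _ FF) => e e0.
apply/(@nbhs_ballP _ R[i]); exists e%:C; first by rewrite /= ltcR.
move=> x; rewrite -ball_normE /= => zx.
by rewrite -ReB -ltcR (le_lt_trans (normc_ge_Re _)).
Qed.

Lemma Im_continuous : continuous (Im : R[i] -> R).
Proof.
move=> z; have FF : Filter (nbhs z) by exact: nbhs_filter.
apply/(@cvgrPdist_lt _ _ _ _ FF) => e e0.
apply/(@nbhs_ballP _ R[i]); exists e%:C; first by rewrite /= ltcR.
move=> x; rewrite -ball_normE /= => zx.
by rewrite -ImB -ltcR (le_lt_trans (normc_ge_Im _)).
Qed.

Existing Instance summability.totally_filter.

Lemma complex_sumE (I : choiceType) (F : I -> R[i]) (u v : R) :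
  is_sum (fun i => Re (F i)) u -> is_sum (fun i => Im (F i)) v ->
  summability.sum F = u +i* v.
Proof.
move=> Fu Fv; apply: cvg_lim => //; apply/cvgrPdist_lt => e e0.
(* The tolerance ranges over [R[i]], where being positive forces it to be real. *)
have [ei er] : Im e = 0 /\ 0 < Re e.
  by move: e0; rewrite ltcE /= => /andP[/eqP -> ->].
have eE : e = (Re e)%:C by case: e ei {e0 er} => a b /= ->.
have h0 : 0 < Re e / 3 by rewrite divr_gt0.
have [A AP] := (is_sumP _ _).1 Fu _ h0; have [B BP] := (is_sumP _ _).1 Fv _ h0.
exists (A `|` B)%fset => // C /= ABC.
have /AP := fsubset_trans (fsubsetUl A B) ABC.
have /BP := fsubset_trans (fsubsetUr A B) ABC.
rewrite -Re_sum -Im_sum partial_sumE eE => h1 h2.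
apply: le_lt_trans (normc_le _) _; rewrite ReB ImB ltcR /=; lra.
Qed.

End ComplexParts.

(** * Continuous functions given by terms *)

Section TameFunctions.
Variables (R : realType) (n : nat).
Implicit Types F G : 'cV[R[i]]_n -> R.
Local Notation Re := (@complex.Re R).
Local Notation Im := (@complex.Im R).

(** Continuity makes the domains open and the term makes them definable. Both are proved together,
    as the functions concerned are polynomials in the real and imaginary parts. *)
Definition tame F : Prop := continuous F /\ term_fun (fun e => F (env_vec n e)).

Lemma tame_ext F G : tame F -> F =1 G -> tame G.
Proof. by move=> tF /funext <-. Qed.

Lemma tame_cst (c : R) : tame (fun=> c).
Proof. by split; [exact: cst_continuous|exact: term_fun_cst]. Qed.

Lemma tameD F G : tame F -> tame G -> tame (fun w => F w + G w).
Proof.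
move=> [cF tF] [cG tG]; split; last exact: term_funD.
move=> w; have FF : Filter (nbhs w) by exact: nbhs_filter.
exact: cvgD (cF w) (cG w).
Qed.

Lemma tameM F G : tame F -> tame G -> tame (fun w => F w * G w).
Proof.
move=> [cF tF] [cG tG]; split; last exact: term_funM.
move=> w; have FF : Filter (nbhs w) by exact: nbhs_filter.
exact: cvgM (cF w) (cG w).
Qed.

Lemma tameN F : tame F -> tame (fun w => - F w).
Proof.
by move=> /(tameM (tame_cst (-1)))/tame_ext; apply => w; rewrite mulN1r.
Qed.

Lemma tame_sum (J : Type) (s : seq J) (F : J -> 'cV[R[i]]_n -> R) :
  (forall j, tame (F j)) -> tame (fun w => \sum_(j <- s) F j w).
Proof.
move=> tF; elim: s => [|j s IH].
  by apply: (tame_ext (tame_cst 0)) => w; rewrite big_nil.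
by apply: (tame_ext (tameD (tF j) IH)) => w; rewrite big_cons.
Qed.

Lemma tame_Re i : tame (fun w => Re (w i 0)).
Proof.
split; last by apply: (term_fun_ext (term_fun_var R i)) => e; rewrite mxE.
move=> w; apply: (@continuous_comp _ _ _ (fun M : 'cV[R[i]]_n => M i 0) Re).
  exact: coord_continuous.
exact: Re_continuous.
Qed.

Lemma tame_Im i : tame (fun w => Im (w i 0)).
Proof.
split; last by apply: (term_fun_ext (term_fun_var R (n + i))) => e; rewrite mxE.
move=> w; apply: (@continuous_comp _ _ _ (fun M : 'cV[R[i]]_n => M i 0) Im).
  exact: coord_continuous.
exact: Im_continuous.
Qed.

Lemma tame_near_gt F (c : R) w : tame F -> c < F w -> \forall x \near w, c < F x.
Proof.
move=> [cF _] cw; have FF : Filter (nbhs w) by exact: nbhs_filter.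
exact: (cvgr_gt _ (cF w)).
Qed.

Lemma tame_near_lt F (c : R) w : tame F -> F w < c -> \forall x \near w, F x < c.
Proof.
move=> [cF _] cw; have FF : Filter (nbhs w) by exact: nbhs_filter.
exact: (cvgr_lt _ (cF w)).
Qed.

End TameFunctions.

Arguments tame_cst : clear implicits.
Arguments tame_Re : clear implicits.
Arguments tame_Im : clear implicits.

Section FormsPosdef.
Variables (R : realType) (g : nat) (W : 'M[int]_g) (alpha : R) (T : nat).

(** Keeps the open pieces inside the Siegel half space, although [beta] may leave the cone there: up
    to positive factors the form is a nonnegative combination of the positive linear forms. *)
Lemma forms_posdef (y : 'cV[R]_g) (beta : 'M[R]_g) : \det W != 0 ->
  (forall t, 0 < lin_form W alpha T y beta t) -> posdefmx beta.
Proof.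
move=> dW lf x x0.
have uW : intrmx R W \in unitmx.
  by rewrite unitmxE /intrmx det_map_mx /= unitfE intr_eq0.
pose x' := invmx (intrmx R W) *m x.
have xE : x = intrmx R W *m x' by rewrite /x' mulKVmx.
have x'0 : x' != 0.
  by apply: contraNneq x0 => E; rewrite xE E mulmx0.
have -> : qform beta x = qform (tilted W beta) (\col_i x' i 0).
  have -> : \col_i x' i 0 = x' by apply/matrixP => i j; rewrite ord1 mxE.
  by rewrite xE /qform /tilted trmx_mul !mulmxA.
rewrite -(@pmulr_rgt0 _ 4)// (offdiag_identity W alpha T y).
have [j xj] : exists j, x' j 0 != 0.
  apply: contrapT => H; move/eqP: x'0; apply; apply/matrixP => i z; rewrite ord1 [RHS]mxE.
  by apply: contrapT => /eqP xi; apply: H; exists i.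
(* The two forms attached to [i] with opposite signs add up to [2 * alpha * beta i i], which is
   therefore positive. *)
have cf i : 0 < lin_form W alpha T y beta (inl (inl i)) + alpha * beta i i.
  apply: addr_gt0 => //.
  have := lf (inr (i, true)); have := lf (inr (i, false)); rewrite /= /sgb; lra.
apply: ltr_pwDl; last first.
  apply: sumr_ge0 => i _; apply: sumr_ge0 => l _.
  by apply: addr_ge0; apply: mulr_ge0; rewrite ?(ltW (lf _))//= sqr_ge0.
rewrite (bigD1 j)//=; apply: ltr_pwDl.
  by apply: mulr_gt0; [rewrite /= mulr_gt0// exprn_even_gt0|exact: cf].
by apply: sumr_ge0 => i _; apply: mulr_ge0; rewrite ?(ltW (cf _))//= mulr_ge0// sqr_ge0.
Qed.

End FormsPosdef.

Section RealImagParts.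
Variables (R : realType) (g : nat).
Local Notation Re := (@complex.Re R).
Local Notation Im := (@complex.Im R).
Local Notation C x := (map_mx (real_complex R) x).

Lemma Re_qform (tau : 'M[R[i]]_g) (x : 'cV[R]_g) :
  Re (qform tau (C x)) = qform (map_mx Re tau) x.
Proof.
rewrite /qform !mxE Re_sum; apply: eq_bigr => j _; rewrite !mxE ReMC Re_sum.
by congr (_ * _); apply: eq_bigr => i _; rewrite !mxE ReCM.
Qed.

Lemma Im_qform (tau : 'M[R[i]]_g) (x : 'cV[R]_g) :
  Im (qform tau (C x)) = qform (map_mx Im tau) x.
Proof.
rewrite /qform !mxE Im_sum; apply: eq_bigr => j _; rewrite !mxE ImMC Im_sum.
by congr (_ * _); apply: eq_bigr => i _; rewrite !mxE ImCM.
Qed.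

Lemma Re_dot (z : 'cV[R[i]]_g) (x : 'cV[R]_g) : Re (dot (C x) z) = dot x (map_mx Re z).
Proof. by rewrite /dot !mxE Re_sum; apply: eq_bigr => j _; rewrite !mxE ReCM. Qed.

Lemma Im_dot (z : 'cV[R[i]]_g) (x : 'cV[R]_g) : Im (dot (C x) z) = dot x (map_mx Im z).
Proof. by rewrite /dot !mxE Im_sum; apply: eq_bigr => j _; rewrite !mxE ImCM. Qed.

Lemma cexp_pi_i (X : R[i]) : cexp ((pi : R)%:C * 'i * X) =
  (expR (- (pi * Im X)) * cos (pi * Re X)) +i* (expR (- (pi * Im X)) * sin (pi * Re X)).
Proof.
have E : (pi : R)%:C * 'i * X = (- (pi * Im X)) +i* (pi * Re X).
  by case: X => u v; apply/eqP; rewrite eq_complex /=; apply/andP; split; apply/eqP; ring.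
by rewrite /cexp E.
Qed.

Lemma natC2 : (2 : R[i]) = (2 : R)%:C. Proof. by rewrite rmorph_nat. Qed.

Lemma Re_quad (tau : 'M[R[i]]_g) (z : 'cV[R[i]]_g) (x : 'cV[R]_g) :
  Re (qform tau (C x) + 2 * dot (C x) z) = qform (map_mx Re tau) x + 2 * dot x (map_mx Re z).
Proof. by rewrite ReD Re_qform natC2 ReCM Re_dot. Qed.

Lemma Im_quad (tau : 'M[R[i]]_g) (z : 'cV[R[i]]_g) (x : 'cV[R]_g) :
  Im (qform tau (C x) + 2 * dot (C x) z) = qform (map_mx Im tau) x + 2 * dot x (map_mx Im z).
Proof. by rewrite ImD Im_qform natC2 ImCM Im_dot. Qed.

Lemma intr_mxC (k : 'cV[int]_g) : map_mx intr k = C (intrmx R k) :> 'cV[R[i]]_g.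
Proof. by apply/matrixP => i j; rewrite !mxE rmorph_int. Qed.

End RealImagParts.

(** * The open pieces and the theta function on them *)

Section ThetaDomain.
Variables (R : realType) (g : nat) (a b : 'cV[R]_g).
Variables (W : 'M[int]_g) (alpha : R) (T : nat) (eps rho : R).
Hypotheses (T0 : (0 < T)%N) (eps0 : 0 < eps) (rho0 : 0 < rho).
Local Notation Re := (@complex.Re R).
Local Notation Im := (@complex.Im R).
Local Notation n := (g + dim_sym g)%N.
Implicit Type w : 'cV[R[i]]_n.

Definition re_vec w : 'cV[R]_n := map_mx Re w.
Definition im_vec w : 'cV[R]_n := map_mx Im w.

(** The vector part of [z + tau a], applied to real and imaginary parts separately; the real vector
    [b] only shifts the real part. *)
Definition shifted (x : 'cV[R]_n) : 'cV[R]_g := usubmx x + symmx (dsubmx x) *m a.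

(** The determinant condition does not involve [w]: it empties the pieces of singular matrices, so
    that [W] may range over all matrices with bounded entries. *)
Definition theta_domain : set 'cV[R[i]]_n :=
  [set w | [/\ \det W != 0,
    forall t, eps < lin_form W alpha T (shifted (im_vec w)) (symmx (dsubmx (im_vec w))) t &
    forall i, `|Re (w i 0)| < rho]].

Lemma tame_sym_Re i j : tame (fun w => symmx (dsubmx (re_vec w)) i j).
Proof. by apply: (tame_ext (tame_Re R n (rshift g (sym_ord i j)))) => w; rewrite !mxE. Qed.

Lemma tame_sym_Im i j : tame (fun w => symmx (dsubmx (im_vec w)) i j).
Proof. by apply: (tame_ext (tame_Im R n (rshift g (sym_ord i j)))) => w; rewrite !mxE. Qed.

Lemma tame_shifted_Re i : tame (fun w => shifted (re_vec w) i 0).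
Proof.
have := tameD (tame_Re R n (lshift (dim_sym g) i))
  (tame_sum (index_enum _) (fun j => tameM (tame_sym_Re i j) (tame_cst R n (a j 0)))).
by move=> /tame_ext; apply => w; rewrite !mxE.
Qed.

Lemma tame_shifted_Im i : tame (fun w => shifted (im_vec w) i 0).
Proof.
have := tameD (tame_Im R n (lshift (dim_sym g) i))
  (tame_sum (index_enum _) (fun j => tameM (tame_sym_Im i j) (tame_cst R n (a j 0)))).
by move=> /tame_ext; apply => w; rewrite !mxE.
Qed.

Lemma tame_tilted i j : tame (fun w => tilted W (symmx (dsubmx (im_vec w))) i j).
Proof.
have := tame_sum (index_enum _) (fun k : 'I_g => tame_sum (index_enum _) (fun l : 'I_g =>
  tameM (tameM (tame_cst R n (col i (map_mx intr W) k 0)) (tame_sym_Im k l))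
        (tame_cst R n (col j (map_mx intr W) l 0)))).
by move=> /tame_ext; apply => w; rewrite tiltedE bformE.
Qed.

Lemma tame_tilted_vec i : tame (fun w => tilted_vec W (shifted (im_vec w)) i 0).
Proof.
have := tameM (tame_cst R n (rdet R W)) (tame_sum (index_enum _) (fun k : 'I_g =>
  tameM (tame_cst R n ((intrmx R W)^T i k)) (tame_shifted_Im k))).
by move=> /tame_ext; apply => w; rewrite /tilted_vec [RHS]mxE [X in _ = _ * X]mxE.
Qed.

Lemma tame_lin_form t :
  tame (fun w => lin_form W alpha T (shifted (im_vec w)) (symmx (dsubmx (im_vec w))) t).
Proof.
case: t => [[j|[[i j] s]]|[i s]] /=.
- apply: tameD; last first.
    by apply/tameN/tameM; [exact: tame_cst|exact: tame_sym_Im].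
  apply: tameD; first exact: tame_tilted.
  apply/tameN/tameM; first exact: tame_cst.
  by apply: tame_sum => i; exact: tame_sym_Im.
- apply: tameD; first by apply: tameM; [exact: tame_cst|exact: tame_sym_Im].
  apply: tameM; first exact: tame_cst.
  by case: eqP => _; [exact: tame_cst|exact: tame_tilted].
- apply: tameD; first by apply: tameM; [exact: tame_cst|exact: tame_sym_Im].
  apply: tameM; first exact: tame_cst.
  by apply: tameM; [exact: tame_tilted_vec|exact: tame_cst].
Qed.

Lemma theta_domain_open : open theta_domain.
Proof.
rewrite openE => w [dW lf Rw]; rewrite /interior.
have FF : Filter (nbhs w) by exact: nbhs_filter.
near=> x; split => //.
- near: x; apply: filter_forall => t; apply: tame_near_gt => //.
  exact: tame_lin_form.
- near: x; apply: filter_forall => i; have := Rw i; rewrite ltr_norml => /andP[h1 h2].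
  apply: filterS2 (tame_near_gt (tame_Re R n i) h1) (tame_near_lt (tame_Re R n i) h2).
  by move=> x ? ?; rewrite ltr_norml; apply/andP.
Unshelve. all: by end_near. Qed.

Lemma theta_domain_siegel w : theta_domain w -> siegel (symmx (dsubmx w)).
Proof.
move=> [dW lf _]; split; first by apply/symmxP; exists (dsubmx w).
have -> : map_mx Im (symmx (dsubmx w)) = symmx (dsubmx (im_vec w)).
  by apply/matrixP => i j; rewrite !mxE.
apply: (@forms_posdef _ _ W alpha T (shifted (im_vec w))) => // t.
exact: lt_trans eps0 (lf t).
Qed.

Lemma theta_domain_form : form_set (fun e => theta_domain (env_vec n e)).
Proof.
have [dW|dW] := eqVneq (\det W) 0.
  apply: (form_set_ext (form_set_lt (term_fun_cst 0) (term_fun_cst 0))) => e.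
  by rewrite ltxx; split=> // -[]; rewrite dW eqxx.
have := form_setI (form_set_forall (fun t =>
    form_set_lt (term_fun_cst eps) (tame_lin_form t).2))
  (form_set_forall (fun i : 'I_n => form_setI
    (form_set_lt (term_fun_cst (- rho)) (tame_Re R n i).2)
    (form_set_lt (tame_Re R n i).2 (term_fun_cst rho)))).
move=> /form_set_ext; apply => e; split.
  move=> [lf Rw]; split => // i; have [h1 h2] := Rw i.
  by rewrite ltr_norml; apply/andP.
move=> [_ lf Rw]; split => // i; have := Rw i.
by rewrite ltr_norml => /andP.
Qed.

Definition theta_char_at w : R[i] := theta_char a b (usubmx w) (symmx (dsubmx w)).

(** The exponential in front of theta has modulus [E], an unrestricted exponential, and phase [th],
    which is bounded on the domain and so admits a restricted cosine. Theta itself is [P] times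
    [fc + i fs], with real and imaginary parts from [theta_piece]. *)
Lemma theta_domain_term : exists fr fi, [/\ term_fun fr, term_fun fi &
  forall e, theta_domain (env_vec n e) -> theta_char_at (env_vec n e) = fr e +i* fi e].
Proof.
have [dW|dW] := eqVneq (\det W) 0.
  exists (fun=> 0), (fun=> 0); split; try exact: term_fun_cst.
  by move=> e []; rewrite dW eqxx.
pose A := \sum_i `|a i 0|; pose B := \sum_i `|b i 0|.
have A0 : 0 <= A by apply: sumr_ge0.
have B0 : 0 <= B by apply: sumr_ge0.
have aA i : `|a i 0| <= A by rewrite /A (bigD1 i)//= lerDl sumr_ge0.
have bB i : `|b i 0| <= B by rewrite /B (bigD1 i)//= lerDl sumr_ge0.
(* Bounds the real parts of both [tau] and [z + tau a + b] on the domain. *)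
pose Rb := rho + rho * A + B.
have Rb0 : 0 < Rb by rewrite /Rb -addrA ltr_wpDr// addr_ge0// mulr_ge0// ltW.
have [fc rfc fcP] := theta_piece alpha dW T0 eps0 Rb0 0.
have [fs rfs fsP] := theta_piece alpha dW T0 eps0 Rb0 (- (pi / 2)).
pose xt w := symmx (dsubmx (re_vec w)); pose be w := symmx (dsubmx (im_vec w)).
pose th w : R := pi * (qform (xt w) a + 2 * dot a (usubmx (re_vec w) + b)).
pose E w : R := expR (- (pi * (qform (be w) a + 2 * dot a (usubmx (im_vec w))))).
pose P w : R := expR (4 * piece_rate R W * (alpha * T%:R ^+ 2 * \sum_i be w i i)).
pose cc w := \col_j piece_coord W alpha T eps Rb (shifted (re_vec w) + b) (xt w)
   (shifted (im_vec w)) (be w) (@enum_val _ (piece_index g) j).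
have tq (F : 'I_g -> 'I_g -> 'cV[R[i]]_n -> R) : (forall i j, tame (F i j)) ->
    tame (fun w => qform (\matrix_(i, j) F i j w) a).
  move=> tF; have := tame_sum (index_enum _) (fun k : 'I_g => tame_sum (index_enum _) (fun l : 'I_g =>
    tameM (tameM (tame_cst R n (a k 0)) (tF k l)) (tame_cst R n (a l 0)))).
  move=> /tame_ext; apply => w; rewrite qform_bform bformE; apply: eq_bigr => k _.
  by apply: eq_bigr => l _; rewrite mxE.
have td (F : 'I_g -> 'cV[R[i]]_n -> R) : (forall i, tame (F i)) ->
    tame (fun w => dot a (\col_i F i w)).
  move=> tF; have := tame_sum (index_enum _) (fun k : 'I_g => tameM (tame_cst R n (a k 0)) (tF k)).
  by move=> /tame_ext; apply => w; rewrite /dot mxE; apply: eq_bigr => k _; rewrite !mxE.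
have tth : tame th.
  have := tameM (tame_cst R n pi) (tameD (tq _ tame_sym_Re) (tameM (tame_cst R n 2)
    (td _ (fun i => tameD (tame_Re R n (lshift (dim_sym g) i)) (tame_cst R n (b i 0)))))).
  move=> /tame_ext; apply => w; rewrite /th.
  have -> : xt w = \matrix_(i, j) symmx (dsubmx (re_vec w)) i j.
    by apply/matrixP => i j; rewrite [RHS]mxE.
  have -> // : usubmx (re_vec w) + b = \col_i (Re (w (lshift (dim_sym g) i) 0) + b i 0).
  by apply/matrixP => i j; rewrite ord1 !mxE.
have tE : term_fun (fun e => E (env_vec n e)).
  apply: term_fun_expR; apply: (proj2 (_ : tame (fun w => - (pi *
    (qform (be w) a + 2 * dot a (usubmx (im_vec w))))))).
  apply: tameN; have := tameM (tame_cst R n pi) (tameD (tq _ tame_sym_Im) (tameM (tame_cst R n 2)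
    (td _ (fun i => tame_Im R n (lshift (dim_sym g) i))))).
  move=> /tame_ext; apply => w.
  have -> : be w = \matrix_(i, j) symmx (dsubmx (im_vec w)) i j.
    by apply/matrixP => i j; rewrite [RHS]mxE.
  have -> // : usubmx (im_vec w) = \col_i Im (w (lshift (dim_sym g) i) 0).
  by apply/matrixP => i j; rewrite ord1 !mxE.
have tP : term_fun (fun e => P (env_vec n e)).
  apply: term_fun_expR; apply: term_funM; first exact: term_fun_cst.
  apply: term_funM; first exact: term_fun_cst.
  by apply: term_fun_sum => i; exact: (tame_sym_Im i i).2.
have tcc (f : 'cV[R]_#|piece_index g| -> R) : restricted_analytic f ->
    term_fun (fun e => f (cc (env_vec n e))).
  move=> rf; apply: (term_fun_an rf) => j; case: (enum_val j) => [[t|[i l]]|i] /=.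
  - apply: term_fun_expR; apply: term_funN; apply: term_funM; first exact: term_fun_cst.
    by apply: term_funB; [exact: (tame_lin_form t).2|exact: term_fun_cst].
  - by apply: term_funM; [exact: term_fun_cst|exact: (tame_sym_Re i l).2].
  - apply: term_funM; first exact: term_fun_cst.
    apply: (term_fun_ext (term_funD (tame_shifted_Re i).2 (term_fun_cst (b i 0)))) => e.
    by rewrite [RHS]mxE.
(* Bound for the phase [th]; the added 1 keeps it positive when [a] is zero. *)
pose Lm : R := pi * ((g * g)%:R * (A * rho * A) + 2 * (g%:R * (A * (rho + B)))) + 1.
have Lm0 : 0 < Lm.
  rewrite /Lm ltr_wpDl// mulr_ge0 ?pi_ge0// addr_ge0// ?mulr_ge0// ?addr_ge0// ltW//.
have [hc thc hcP] := term_fun_cos_bounded 0 tth.2 Lm0.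
have [hs ths hsP] := term_fun_cos_bounded (- (pi / 2)) tth.2 Lm0.
have cos_sin (x : R) : cos (x + - (pi / 2)) = sin x.
  by rewrite cosB cos_pihalf sin_pihalf mulr0 mulr1 add0r.
exists (fun e => E (env_vec n e) * (P (env_vec n e) *
    (hc e * fc (cc (env_vec n e)) - hs e * fs (cc (env_vec n e))))),
  (fun e => E (env_vec n e) * (P (env_vec n e) *
    (hc e * fs (cc (env_vec n e)) + hs e * fc (cc (env_vec n e))))).
split.
- apply: term_funM => //; apply: term_funM => //.
  by apply: term_funB; apply: term_funM => //; exact: tcc.
- apply: term_funM => //; apply: term_funM => //.
  by apply: term_funD; apply: term_funM => //; exact: tcc.
move=> e; move: (hcP e) (hsP e); move: (env_vec n e) => w hcw hsw [_ lf Rw].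
have xtR i j : `|xt w i j| <= rho by rewrite !mxE ltW.
have rhoRb : rho <= Rb by rewrite /Rb -addrA lerDl addr_ge0// mulr_ge0// ltW.
have thL : `|th w| <= Lm.
  rewrite /th /Lm normrM (ger0_norm (pi_ge0 R)) -[leLHS]addr0 lerD//.
  rewrite ler_wpM2l ?pi_ge0// (le_trans (ler_normD _ _))// lerD//.
    apply: bform_le => i j; rewrite !normrM; apply: ler_pM; rewrite ?mulr_ge0//.
    by apply: ler_pM.
  rewrite normrM normr_nat ler_pM2l// /dot mxE (le_trans (ler_norm_sum _ _ _))//.
  apply: (@le_trans _ _ (\sum_(i < g) A * (rho + B))); last first.
    by rewrite sumr_const card_ord mulr_natl.
  apply: ler_sum => i _; rewrite mxE normrM; apply: ler_pM => //.
  by rewrite !mxE (le_trans (ler_normD _ _))// lerD// ltW.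
have zR i : `|(shifted (re_vec w) + b) i 0| <= Rb.
  rewrite mxE (le_trans (ler_normD _ _))// /Rb lerD//.
  rewrite mxE (le_trans (ler_normD _ _))// lerD//; first by rewrite !mxE ltW.
  rewrite mxE (le_trans (ler_norm_sum _ _ _))// mulr_sumr; apply: ler_sum => j _.
  by rewrite normrM ler_wpM2r//; exact: xtR.
have lf' t : eps <= lin_form W alpha T (shifted (im_vec w)) (be w) t by rewrite ltW// lf.
have xtRb i j : `|xt w i j| <= Rb by rewrite (le_trans (xtR i j)).
have Sc := fcP _ _ _ _ lf' zR xtRb; have Ss := fsP _ _ _ _ lf' zR xtRb.
rewrite /theta_char_at /theta_char.
set tau := symmx (dsubmx w).
have Etau : map_mx Re tau = xt w by apply/matrixP => i j; rewrite !mxE.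
have Ebe : map_mx Im tau = be w by apply/matrixP => i j; rewrite !mxE.
set zt := usubmx w + _ + _.
have Ezr : map_mx Re zt = shifted (re_vec w) + b.
  apply/matrixP => i j; rewrite ord1 /shifted !mxE !ReD Re_sum; congr (_ + _ + _).
  by apply: eq_bigr => l _; rewrite !mxE ReMC.
have Ezi : map_mx Im zt = shifted (im_vec w).
  apply/matrixP => i j; rewrite ord1 /shifted !mxE !ImD Im_sum /= addr0; congr (_ + _).
  by apply: eq_bigr => l _; rewrite !mxE ImMC.
have -> : theta zt tau = (P w * fc (cc w)) +i* (P w * fs (cc w)).
  rewrite /theta; apply: complex_sumE.
    apply: (eq_is_sum Sc) => k; rewrite intr_mxC cexp_pi_i Re_quad Im_quad /=.
    by rewrite Etau Ebe Ezr Ezi addr0.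
  apply: (eq_is_sum Ss) => k; rewrite intr_mxC cexp_pi_i Re_quad Im_quad /=.
  by rewrite Etau Ebe Ezr Ezi cos_sin.
rewrite cexp_pi_i Re_quad Im_quad Etau Ebe.
have -> : map_mx Re (usubmx w + map_mx (real_complex R) b) = usubmx (re_vec w) + b.
  by apply/matrixP => i j; rewrite ord1 !mxE ReD.
have -> : map_mx Im (usubmx w + map_mx (real_complex R) b) = usubmx (im_vec w).
  by apply/matrixP => i j; rewrite ord1 !mxE ImD /= addr0.
rewrite -/(th w) -/(E w) hcw// hsw// addr0 cos_sin.
by apply/eqP; rewrite eq_complex /=; apply/andP; split; apply/eqP; ring.
Qed.

End ThetaDomain.

Theorem theorem6p5 (R : realType) (g : nat) (hg : (0 < g)%N)
    (a b : 'cV[R]_g) (m d r : R) (hm : 0 < m) (hd : 0 < d) (hr : 0 < r) :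
  exists U : set 'cV[R[i]]_(g + dim_sym g),
    [/\ open U,
        tube r (cone_C_ge hg m d) `<=` U,
        (forall w, U w -> siegel (symmx (dsubmx w))) &
        definable_on U
          (fun w => theta_char a b (usubmx w) (symmx (dsubmx w)))].
Proof.
pose A := \sum_j `|a j 0|.
have A0 : 0 <= A by apply: sumr_ge0.
(* On the cone [|beta i j| <= beta i i], so passing from [y] to [y + beta a] enlarges the slope [m]
   by at most [A]. *)
have [K [alpha [T [T0 cover]]]] := @cone_covered R g (m + A) d hg (ltr_wpDr A0 hm) hd.
(* A finite type of indices: entries between 0 and [2 K], shifted to lie between [- K] and [K]. *)
pose W (t : 'M['I_(K + K).+1]_g) : 'M[int]_g := \matrix_(i, j) ((t i j : nat)%:Z - K%:Z).
have d2 : 0 < d / 2 by rewrite divr_gt0.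
have r1 : 0 < r + 1 by rewrite addr_gt0.
(* The bounds [d] and [r] are relaxed to [d / 2] and [r + 1], so that the closed tube satisfies the
   strict inequalities of the open pieces. *)
pose V t := theta_domain a (W t) alpha T (d / 2) (r + 1).
exists [set w | exists t, V t w]; split.
- rewrite openE => w [t Vw]; apply: (@filterS _ (nbhs w) _ (V t)).
    by move=> x Vx; exists t.
  exact: (theta_domain_open Vw).
- move=> w [Rew [[cw yw] dw]].
  set beta := symmx (dsubmx _) in cw yw.
  have b0 (k : 'I_g) : k = 0%N :> nat -> d <= beta k k.
    by move=> k0; have -> : k = Ordinal hg by apply: val_inj.
  have bg (k : 'I_g) : k = 0%N :> nat -> 0 < beta k k.
    by move=> /b0; exact: lt_le_trans.
  have [|W0 [dW WK lf]] := cover beta cw b0 (shifted a (im_vec w)).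
    move=> i; rewrite mxE (le_trans (ler_normD _ _))// mulrDl lerD//.
    rewrite mxE (le_trans (ler_norm_sum _ _ _))// /A mulr_suml; apply: ler_sum => j _.
    by rewrite normrM mulrC ler_wpM2l//; exact: cone_offdiag.
  pose t : 'M['I_(K + K).+1]_g := \matrix_(i, j) inord (absz (W0 i j + K%:Z)).
  have tW : W t = W0.
    apply/matrixP => i j; rewrite !mxE inordK; have := WK i j; lia.
  exists t; rewrite /V tW; split => //.
    by move=> f; apply: lt_le_trans (lf f); rewrite ltr_pdivrMr//; lra.
  by move=> i; rewrite (le_lt_trans (Rew i))// ltrDl.
- by move=> w [t]; exact: theta_domain_siegel.
- apply: definable_on_cover => t; first exact: theta_domain_form.
  exact: (theta_domain_term a b (W t) alpha T0 d2 r1).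
Qed.
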